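(* Let $\mathbf{W}$ denote the universal (big) Witt vector functor on the category of (commutative, unital) rings, equipped with its comonad structure with counit $\eta E\colon \mathbf{W}\to \mathrm{Id}$ and comultiplication $(E^2)^{-1}\Lambda_t E\colon \mathbf{W}\to\mathbf{W}^2$ (all recalled in the context). For a filtered ring $(R,\{I^n\})$, filter $\mathbf{W}(R)$ by the subsets $\mathbf{W}(I^n)=\{(r_i)\in\mathbf{W}(R) : r_i\in I^n \text{ for all } i\}$. Then: (1) $\mathbf{W}$ restricts to a functor on the category of filtered rings. (2) $\mathbf{W}$, with the counit $\eta E\colon \mathbf{W}\to \mathrm{Id}$ and the comultiplication $(E^2)^{-1}\Lambda_t E\colon \mathbf{W}\to\mathbf{W}^2$, is a comonad on the category of filtered rings. Now regard $\mathbf{W}$ as a comonad on the category of filtered rings and let $(R,\{I^n\})$ be a filtered ring. Then: (3) $\mathbf{W}(R)$ has a canonical filtered $\lambda$-ring structure, namely the one obtained by transporting along the ring isomorphism $E(R)\colon \mathbf{W}(R)\to\Lambda(R)$ the canonical $\lambda$-operations of $\Lambda(R)$. (4) $R$ is complete (resp. Hausdorff) if and only if $\mathbf{W}(R)$ is complete (resp. Hausdorff). (5) There is a canonical bijection between the set of filtered $\lambda$-ring structures on $R$ and the set of $\mathbf{W}$-coalgebra structures on $R$, sending $\{\lambda^i\}$ to the map $E(R)^{-1}\circ\lambda_t\colon R\to\mathbf{W}(R)$, where $\lambda_t(r)=\sum_{i\ge 0}\lambda^i(r)t^i\in\Lambda(R)$. In particular, the set of filtered $\lambda$-ring structures on $R$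 has a canonical topology as the subspace of the space of continuous maps from $R$ to $\mathbf{W}(R)$ (with the compact-open topology, where $R$ and $\mathbf{W}(R)$ carry the topologies generated by their filtrations) consisting of the filtered ring homomorphisms which make $R$ into a $\mathbf{W}$-coalgebra.
   Context: All rings are commutative with unit. A filtered ring is a ring $R$ with a decreasing sequence of ideals $R=I^0\supset I^1\supset\cdots$ with $I^nI^m\subseteq I^{n+m}$. A filtered ring homomorphism $f\colon R\to S$ is a ring map with $f(I_R^n)\subset I_S^n$ for all $n$. $(R,\{I^n\})$ is complete (resp. Hausdorff) if the natural map $R\to\varprojlim R/I^n$ is surjective (resp. injective). A $\lambda$-ring is a ring $R$ with functions $\lambda^i\colon R\to R$ ($i\ge0$) such that $\lambda^0(r)=1$, $\lambda^1(r)=r$, $\lambda^n(1)=0$ for $n>1$, $\lambda^n(r+s)=\sum_{i=0}^n\lambda^i(r)\lambda^{n-i}(s)$, $\lambda^n(rs)=P_n(\lambda^1(r),\ldots,\lambda^n(r);\lambda^1(s),\ldots,\lambda^n(s))$, and $\lambda^m(\lambda^n(r))=P_{m,n}(\lambda^1(r),\ldots,\lambda^{mn}(r))$. Here $P_n,P_{m,n}$ are the standard universal integer polynomials: $P_n$ expresses the coefficient of $t^n$ in $\prod_{i,j}(1+x_iy_jt)$ in terms of the elementary symmetric functions of the $x_i$ and of the $y_j$; $P_{m,n}$ expresses the coefficient of $t^m$ in $\prod_{i_1<\cdots<i_n}(1+x_{i_1}\cdots x_{i_n}t)$ in terms of the elementary symmetric functions of the $x_i$. A filtered $\lambda$-ring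 is a filtered ring which is also a $\lambda$-ring such that every filtration ideal is closed under $\lambda^i$ for all $i>0$. A comonad on a category $\mathbf{C}$ is an endofunctor $F$ with natural transformations $\eta\colon F\to\mathrm{Id}$ (counit) and $\mu\colon F\to F^2$ (comultiplication) satisfying $F\eta\circ\mu=\mathrm{Id}=\eta F\circ\mu$ and $F\mu\circ\mu=\mu F\circ\mu$. An $F$-coalgebra structure on an object $X$ is a morphism $\xi\colon X\to FX$ in $\mathbf{C}$ with $F\xi\circ\xi=\mu\circ\xi$ and $\eta\circ\xi=\mathrm{Id}_X$. For a ring $A$, $\Lambda(A)$ is the set of power series $1+\sum_{i\ge1}a_it^i\in A[[t]]$, with addition $+_\Lambda$ the multiplication of power series and with multiplication $(1+\sum a_it^i)\cdot_\Lambda(1+\sum b_it^i)=1+\sum_{i\ge1}P_i(a_1,\ldots,a_i;b_1,\ldots,b_i)t^i$; ring maps act on coefficients. $\Lambda$ is a comonad on rings with counit $\eta(1+\sum a_it^i)=a_1$ and comultiplication $\Lambda_t(f)=1+\sum_{i\ge1}\lambda^i(f)t^i$, where for $f=1+\sum a_it^i$ and $i>0$ one sets $\lambda^i(f)=1+\sum_{j\ge1}P_{j,i}(a_1,\ldots,a_{ij})t^j$. With these operations $\lambda^i$, $\Lambda(A)$ is a $\lambda$-ring (its canonical $\lambda$-ring structure). For a ring $A$, $\mathbf{W}(A)=\prod_{i=1}^\infty A$ as a set, with the unique functorial ring structure such that the maps $w_n(\mathbf{a})=\sum_{d\mid n}d\,a_d^{n/d}$ ($n\ge1$) are ring homomorphisms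 $\mathbf{W}(A)\to A$; ring maps act componentwise. The exponential isomorphism $E(A)\colon\mathbf{W}(A)\to\Lambda(A)$, $(a_i)\mapsto\prod_{i\ge1}(1-a_i(-t)^i)$, is a natural ring isomorphism. $E^2\colon\mathbf{W}^2\to\Lambda^2$ denotes the composite of $E$ applied at $\mathbf{W}$, $\mathbf{W}\mathbf{W}\to\Lambda\mathbf{W}$, followed by $\Lambda E\colon\Lambda\mathbf{W}\to\Lambda\Lambda$. *)

(* Defs.v *)
(* MathComp, with MathComp-Analysis for sets and topology.  Rings are
   [comPzRingType]s, so that the zero ring is included. *)
From HB Require Import structures.
From mathcomp Require Import all_boot all_order all_algebra finmap.
From mathcomp Require mpoly monalg.
From mathcomp Require Import all_classical topology.

Set Implicit Arguments.
Unset Strict Implicit.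
Unset Printing Implicit Defensive.

Import GRing.Theory.
Local Open Scope ring_scope.

Section IntPoly.
Import monalg.

(* Integer polynomials in a possibly infinite set I of variables; evaluation is
   redefined because the one of the library excludes the zero ring. *)
Definition ipoly (I : choiceType) : comNzRingType := {malg int[{cmonom I}]}.
Definition ivar (I : choiceType) (i : I) : ipoly I := mkmalgU (ucm i) 1.

Definition mon_eval (I : choiceType) (A : comPzRingType) (v : I -> A)
  (k : {cmonom I}) : A := \prod_(i <- finsupp k) v i ^+ k i.

Definition ipoly_eval (I : choiceType) (A : comPzRingType) (v : I -> A)
  (g : ipoly I) : A := \sum_(k <- msupp g) mon_eval v k *~ mcoeff k g.

Section Eval.
Variables (I : choiceType) (A : comPzRingType) (v : I -> A).

Lemma mon_evalE (k : {cmonom I}) (d : {fset I}) : (finsupp k `<=` d)%fset ->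
  mon_eval v k = \prod_(i <- d) v i ^+ k i.
Proof.
move=> le; rewrite /mon_eval (big_fset_incl _ le) // => i _.
by rewrite -cmE_eq0 => /eqP ->; rewrite expr0.
Qed.

Lemma mon_eval_mmorph :
  mon_eval v mone = 1 /\ {morph mon_eval v : x y / mmul x y >-> x * y}.
Proof.
split; first by rewrite /mon_eval mdom1 big_seq_fset0.
move=> x y; rewrite [LHS]/mon_eval mdomD.
rewrite (mon_evalE (fsubsetUl _ (finsupp y))).
rewrite (mon_evalE (fsubsetUr (finsupp x) _)) -big_split /=.
by apply: eq_bigr => i _; rewrite cmM exprD.
Qed.

Lemma ipoly_eval_rmorph :
  zmod_morphism (ipoly_eval v) /\ monoid_morphism (ipoly_eval v).
Proof.
have [A0|A1] := eqVneq (1 : A) 0.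
  have all0 (x y : A) : x = y by rewrite -[x]mul1r -[y]mul1r A0 !mul0r.
  by split=> [x y|]; [apply: all0 | split=> [|x y]; apply: all0].
pose isn := GRing.PzSemiRing_isNonZero.Build A A1.
pose B : comNzRingType := HB.pack A isn.
pose hm := isMultiplicative.Build _ B (mon_eval v : {cmonom I} -> B)
   (conj mon_eval_mmorph.2 mon_eval_mmorph.1).
pose h : {mmorphism {cmonom I} -> B} := HB.pack (mon_eval v : _ -> B) hm.
pose e : {rmorphism int -> B} := intr.
have E g : ipoly_eval v g = mmap e h g.
  by rewrite /mmap; apply: eq_bigr => k _; rewrite /= -mulrzl.
have [hM h1] := mmap_is_multiplicative (f := e) (h := h).
split=> [x y|]; first by rewrite !E; apply: (mmap_is_additive (f := e)).
by split=> [|x y]; rewrite !E; [apply: h1 | apply: hM].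
Qed.



HB.instance Definition _ := GRing.isZmodMorphism.Build _ _ (ipoly_eval v)
  ipoly_eval_rmorph.1.
HB.instance Definition _ := GRing.isMonoidMorphism.Build _ _ (ipoly_eval v)
  ipoly_eval_rmorph.2.

Lemma ipoly_eval_var i : ipoly_eval v (ivar i) = v i.
Proof.
rewrite /ipoly_eval /ivar msuppU1 big_seq_fset1 mcoeffUU mulr1z.
by rewrite /mon_eval mdomU big_seq_fset1 cmUU expr1.
Qed.

End Eval.

Lemma ipoly_eval_comp (I : choiceType) (A B : comPzRingType)
    (f : {rmorphism A -> B}) (v : I -> A) (g : ipoly I) :
  f (ipoly_eval v g) = ipoly_eval (f \o v) g.
Proof.
rewrite /ipoly_eval raddf_sum; apply: eq_bigr => k _; rewrite raddfMz.
rewrite /mon_eval /= rmorph_prod; congr (_ *~ _).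
by apply: eq_bigr => i _; rewrite rmorphXn.
Qed.

Lemma ipoly_eval_id (I : choiceType) (g : ipoly I) :
  ipoly_eval (@ivar I) g = g.
Proof.
rewrite [RHS]monalgE; apply: eq_bigr => k _.
suff -> : mon_eval (@ivar I) k = mkmalgU k 1.
  by rewrite -[in RHS](intz (mcoeff k g)) raddfMz.
have morM (x y : {cmonom I}) :
    (mkmalgU x 1 : ipoly I) * mkmalgU y 1 = mkmalgU (mmul x y) 1.
  by rewrite [LHS]fgmulUU mulr1.
have morX (k' : {cmonom I}) n : exists2 m : {cmonom I},
    (mkmalgU k' 1 : ipoly I) ^+ n = mkmalgU m 1 & forall i, m i = (n * k' i)%N.
  elim: n => [|n [m e E]]; first by exists mone => // i; rewrite cm1.
  exists (mmul k' m); last by move=> i; rewrite cmM E mulSn.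
  rewrite exprS e morM; reflexivity.
have H (s : seq I) : uniq s -> exists2 m : {cmonom I},
    \prod_(i <- s) ivar i ^+ k i = mkmalgU m 1 :> ipoly I
      & forall i, m i = if i \in s then k i else 0%N.
  elim: s => [|i s IH] /=; first by exists mone; rewrite ?big_nil // => i; rewrite cm1.
  case/andP=> is_ /IH [m e E]; have [m' e' E'] := morX (ucm i) (k i).
  exists (mmul m' m); first (rewrite big_cons e e' morM; reflexivity).
  move=> j; rewrite cmM E E' inE cmU eq_sym.
  by have [->|ne] := eqVneq; rewrite ?(negbTE is_) ?muln1 ?muln0 ?addn0.
have [m e E] := H (finsupp k) (fset_uniq _).
have mk : m = k; last by rewrite mk in e.
apply/eqP/cmP => i; rewrite E.
by case: ifP => // /negbT; rewrite -cmE_eq0 => /eqP.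
Qed.

Lemma ipoly_dvd (I : choiceType) n (g : ipoly I) :
  (forall k, (n%:Z %| mcoeff k g)%Z) -> exists h, g = h *+ n.
Proof.
move=> H; exists (\sum_(k <- msupp g) mkmalgU k (mcoeff k g %/ n%:Z)%Z).
rewrite {1}[g]monalgE -sumrMnl; apply: eq_bigr => k _.
by rewrite -raddfMn /= -{1}(divzK (H k)) -mulr_natr natz.
Qed.

Lemma ipoly_dvd_coef (I : choiceType) n (g h : ipoly I) k :
  g = h *+ n -> (n%:Z %| mcoeff k g)%Z.
Proof. by move=> ->; rewrite mcoeffMn -mulr_natr natz dvdz_mull. Qed.

End IntPoly.

(* W(A) = prod_(i >= 1) A: [wcoef a i] is the component of index i + 1, and
   [wcomp a i] the component of index i >= 1. *)
Record witt (A : Type) := Witt { wcoef : nat -> A }.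

HB.instance Definition _ (A : Type) := [isNew for @wcoef A].
HB.instance Definition _ (A : Type) := gen_eqMixin (witt A).
HB.instance Definition _ (A : Type) := gen_choiceMixin (witt A).

Definition wcomp (A : Type) (a : witt A) (i : nat) : A := wcoef a i.-1.

Lemma wittP (A : Type) (a b : witt A) : (forall i, wcoef a i = wcoef b i) -> a = b.
Proof. by case: a b => [a] [b] /= e; congr Witt; apply/funext. Qed.

Definition ghost (A : comPzRingType) (n : nat) (a : witt A) : A :=
  \sum_(d <- divisors n) (wcomp a d ^+ (n %/ d)) *+ d.

Definition witt_map (A B : Type) (f : A -> B) (a : witt A) : witt B :=
  Witt (fun i => f (wcoef a i)).

Lemma ghost_wmap (A B : comPzRingType) (f : {rmorphism A -> B}) n (a : witt A) :
  ghost n (witt_map f a) = f (ghost n a).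
Proof.
rewrite /ghost raddf_sum; apply: eq_bigr => d _.
by rewrite raddfMn /= rmorphXn.
Qed.

Lemma ghostE (A : comPzRingType) (a : witt A) n N : (0 < n <= N)%N ->
  ghost n a = \sum_(1 <= d < N.+1 | (d %| n)%N) (wcomp a d ^+ (n %/ d)) *+ d.
Proof.
case/andP=> n0 nN; rewrite -[RHS]big_filter; apply: perm_big; apply: uniq_perm.
- exact: divisors_uniq.
- exact/filter_uniq/iota_uniq.
move=> d; rewrite mem_filter mem_index_iota -dvdn_divisors //.
by case: (boolP (d %| n)%N) => //= dn; rewrite (dvdn_gt0 n0 dn) ltnS (leq_trans (dvdn_leq n0 dn)).
Qed.

Lemma ghost_rec (A : comPzRingType) (a : witt A) n : (0 < n)%N ->
  ghost n a = \sum_(1 <= d < n | (d %| n)%N) (wcomp a d ^+ (n %/ d)) *+ d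
              + wcomp a n *+ n.
Proof.
move=> n0; have nn : (0 < n <= n)%N by rewrite n0 leqnn.
rewrite (ghostE a nn) big_mkcond big_nat_recr //=.
by rewrite dvdnn -big_mkcond divnn n0 expr1.
Qed.

Section Divisibility.
Variable A : comPzRingType.
Implicit Types (x y : A) (n p k : nat).

Definition nat_dvd n x := exists y, x = y *+ n.

Lemma nat_dvd0 n : nat_dvd n 0. Proof. by exists 0; rewrite mul0rn. Qed.
Lemma nat_dvdD n x y : nat_dvd n x -> nat_dvd n y -> nat_dvd n (x + y).
Proof. by case=> u -> [v ->]; exists (u + v); rewrite mulrnDl. Qed.
Lemma nat_dvdN n x : nat_dvd n x -> nat_dvd n (- x).
Proof. by case=> u ->; exists (- u); rewrite mulNrn. Qed.
Lemma nat_dvdMl n x y : nat_dvd n x -> nat_dvd n (y * x).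
Proof. by case=> u ->; exists (y * u); rewrite mulrnAr. Qed.
Lemma nat_dvdMr n x y : nat_dvd n x -> nat_dvd n (x * y).
Proof. by rewrite mulrC; apply: nat_dvdMl. Qed.
Lemma nat_dvd_trans n m x : (n %| m)%N -> nat_dvd m x -> nat_dvd n x.
Proof. by case/dvdnP=> k -> [u ->]; exists (u *+ k); rewrite -mulrnA mulnC. Qed.
Lemma nat_dvd_sum (I : Type) (r : seq I) (P : pred I) (F : I -> A) n :
  (forall i, P i -> nat_dvd n (F i)) -> nat_dvd n (\sum_(i <- r | P i) F i).
Proof.
by move=> H; apply: big_ind => //; [apply: nat_dvd0 | apply: nat_dvdD].
Qed.
Lemma nat_dvdMn n m x : nat_dvd n x -> nat_dvd (n * m) (x *+ m).
Proof. by case=> u ->; exists u; rewrite mulrnA. Qed.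

Lemma nat_dvdBX n x y k : nat_dvd n (x - y) -> nat_dvd n (x ^+ k - y ^+ k).
Proof. by move=> H; rewrite subrXX; apply: nat_dvdMr. Qed.

Lemma nat_dvdBXp p k x y :
  nat_dvd (p ^ k.+1) (x - y) -> nat_dvd (p ^ k.+2) (x ^+ p - y ^+ p).
Proof.
move=> H; rewrite subrXX expnSr.
have [z ->] : nat_dvd p (\sum_(i < p) x ^+ (p.-1 - i) * y ^+ i).
  have -> : \sum_(i < p) x ^+ (p.-1 - i) * y ^+ i =
     \sum_(i < p) (x ^+ (p.-1 - i) - y ^+ (p.-1 - i)) * y ^+ i + y ^+ p.-1 *+ p.
    rewrite -[X in _ + _ *+ X](card_ord p) -sumr_const -big_split /=.
    apply: eq_bigr => i _; rewrite mulrBl -exprD subnK ?subrK //.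
    by case: p i {H} => [[]|p [i ltip]].
  apply: nat_dvdD; last by exists (y ^+ p.-1).
  apply: nat_dvd_sum => i _; apply/nat_dvdMr/nat_dvdBX.
  by apply: nat_dvd_trans H; rewrite expnS dvdn_mulr.
by case: H => u ->; exists (u * z); rewrite mulrnAl mulrnAr -mulrnA mulnC.
Qed.

Lemma nat_dvdBXpX p k x y :
  nat_dvd p (x - y) -> nat_dvd (p ^ k.+1) (x ^+ (p ^ k) - y ^+ (p ^ k)).
Proof.
move=> H; elim: k => [|k IH]; first by rewrite expn1 !expn0 !expr1.
by rewrite [(p ^ k.+1)%N]expnSr !exprM; apply: nat_dvdBXp.
Qed.

End Divisibility.

(* Dwork's lemma: over a torsion-free ring with Frobenius lifts, the sequences of
   ghost components are closed under the ring operations. *)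
Section Dwork.
Variable U : comPzRingType.
Hypothesis tf : forall n (x : U), (0 < n)%N -> x *+ n = 0 -> x = 0.
Variable frob : nat -> {rmorphism U -> U}.
Hypothesis frobP : forall p x, prime p -> nat_dvd p (frob p x - x ^+ p).
Hypothesis dvd_part : forall n (x : U), (0 < n)%N ->
  (forall p, prime p -> (p %| n)%N -> nat_dvd (p ^ logn p n) x) -> nat_dvd n x.

Lemma ghost_inj (a b : witt U) : (forall n, (0 < n)%N -> ghost n a = ghost n b) -> a = b.
Proof.
move=> H; apply: wittP => i; rewrite -[wcoef a i]/(wcomp a i.+1) -[wcoef b i]/(wcomp b i.+1).
have: (0 < i.+1)%N by []; move: {i} (i.+1) => n.
have [m] := ubnP n; elim: m n => // m IH n; rewrite ltnS => nm n0.
move: (H n n0); rewrite !ghost_rec //.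
have -> : \sum_(1 <= d < n | (d %| n)%N) wcomp a d ^+ (n %/ d) *+ d =
          \sum_(1 <= d < n | (d %| n)%N) wcomp b d ^+ (n %/ d) *+ d.
  rewrite big_nat_cond [RHS]big_nat_cond.
  apply: eq_bigr => d /andP[/andP[d0 dn] _].
  by rewrite IH // (leq_trans dn).
move=> /addrI /eqP; rewrite -subr_eq0 -mulrnBl => /eqP /(tf n0) /eqP.
by rewrite subr_eq0 => /eqP.
Qed.

Definition ghost_cong (g : nat -> U) := forall p n, prime p -> (p %| n)%N ->
  (0 < n)%N -> nat_dvd (p ^ logn p n) (g n - frob p (g (n %/ p)%N)).

Lemma ghost_congP (a : witt U) : ghost_cong (fun n => ghost n a).
Proof.
move=> p n pp pn n0.
have np0 : (0 < n %/ p)%N by rewrite divn_gt0 ?prime_gt0 // dvdn_leq.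
have nn : (0 < n <= n)%N by rewrite n0 leqnn.
have npn : (0 < n %/ p <= n)%N by rewrite np0 leq_div.
rewrite (ghostE a nn) (ghostE a npn).
rewrite raddf_sum (bigID (fun d => d %| n %/ p)%N) /= addrAC.
apply: nat_dvdD; last first.
  apply: nat_dvd_sum => d /andP[dn Ndn].
  apply: nat_dvd_trans (_ : nat_dvd d _); last by exists (wcomp a d ^+ (n %/ d)).
  have d0 := dvdn_gt0 n0 dn.
  rewrite pfactor_dvdn // leqNgt; apply: contra Ndn => lt.
  case/dvdnP: dn => m nE.
  have m0 : (0 < m)%N by move: n0; rewrite nE muln_gt0 => /andP[].
  move: lt; rewrite nE lognM // -[X in (X < _)%N]add0n ltn_add2r.
  rewrite logn_gt0 mem_primes => /and3P[_ _ pm].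
  by rewrite -divn_mulAC // dvdn_mull.
rewrite [X in X - _](eq_bigl (fun d => d %| n %/ p)%N); last first.
  move=> d; apply: andb_idl => /dvdn_trans; apply.
  by rewrite -{2}(divnK pn) dvdn_mulr.
rewrite -sumrB; apply: nat_dvd_sum => d dnp.
have d0 := dvdn_gt0 np0 dnp.
rewrite raddfMn /= rmorphXn -mulrnBl.
case/dvdnP: dnp => m nE.
have nE' : n = (m * p * d)%N by rewrite -(divnK pn) nE mulnAC.
have m0 : (0 < m)%N by move: np0; rewrite nE muln_gt0 => /andP[].
rewrite nE mulnK // {1 2}nE' mulnK //.
have p0 := prime_gt0 pp.
rewrite lognM ?muln_gt0 ?m0 // expnD.
apply: (@nat_dvd_trans _ _ (p ^ logn p (m * p) * d)).
  by rewrite dvdn_mul // pfactor_dvdnn.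
apply: nat_dvdMn; rewrite lognM // (pfactorK 1) // addn1.
rewrite -opprB; apply: nat_dvdN.
have [q _ mE] := pfactor_coprime pp m0; set k := logn p m in mE *.
set x := wcomp a d.
have -> : x ^+ (m * p) = ((x ^+ p) ^+ (p ^ k)) ^+ q.
  by rewrite mE -!exprM; congr (_ ^+ _); rewrite mulnC mulnA mulnAC -mulnA mulnA.
have -> : frob p x ^+ m = (frob p x ^+ (p ^ k)) ^+ q by rewrite mE mulnC exprM.
apply: nat_dvdBX.
exact/nat_dvdBXpX/frobP.
Qed.

Lemma dwork (g : nat -> U) : ghost_cong g ->
  exists a : witt U, forall n, (0 < n)%N -> ghost n a = g n.
Proof.
move=> gC.
pose part (s : nat -> U) n :=
  \sum_(1 <= d < n | (d %| n)%N) (s d.-1 ^+ (n %/ d)) *+ d.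
pose nxt (s : seq U) n := xget 0 (fun z => z *+ n = g n - part (nth 0 s) n).
pose f := fix f n := if n is m.+1 then rcons (f m) (nxt (f m) n) else [::].
have szf n : size (f n) = n by elim: n => //= n IH; rewrite size_rcons IH.
pose a := Witt (fun i => nth 0 (f i.+1) i).
have fa n j : (j < n)%N -> nth 0 (f n) j = wcoef a j.
  elim: n => // n IH; rewrite ltnS leq_eqVlt => /orP[/eqP -> //|jn].
  by rewrite /= nth_rcons szf jn IH.
have partE (s s' : nat -> U) n : (forall i, (i < n.-1)%N -> s i = s' i) ->
    part s n = part s' n.
  move=> e; rewrite /part big_nat_cond [RHS]big_nat_cond.
  apply: eq_bigr => d /andP[/andP[d0 dn] _]; rewrite e //.
  by case: d d0 dn => // d _; case: n {e} => // n; rewrite ltnS.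
exists a => n; have [m] := ubnP n; elim: m n => // m IH n; rewrite ltnS => nm n0.
rewrite ghost_rec // -[X in X + _]/(part (wcoef a) n).
have aE : wcomp a n = nxt (f n.-1) n.
  by rewrite /wcomp /=; case: n n0 {nm} => // n _; rewrite /= nth_rcons szf ltnn eqxx.
have /(xgetPex 0) : exists z, z *+ n = g n - part (wcoef a) n.
  suff [z zE] : nat_dvd n (g n - part (wcoef a) n) by exists z.
  apply: dvd_part => // p pp pn.
  pose b := Witt (fun i => if (i < n.-1)%N then wcoef a i else 0).
  have bn : ghost n b = part (wcoef a) n.
    rewrite ghost_rec // [wcomp b n]/wcomp /= ltnn mul0rn addr0.
    by apply: (partE (wcoef b)) => i /= ->.
  have np0 : (0 < n %/ p)%N by rewrite divn_gt0 ?prime_gt0 // dvdn_leq.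
  have npn : (n %/ p < n)%N by rewrite ltn_Pdiv // prime_gt1.
  have bnp : ghost (n %/ p) b = g (n %/ p)%N.
    rewrite -IH ?(leq_trans npn) //.
    have nn : (0 < n %/ p <= n %/ p)%N by rewrite np0 leqnn.
    rewrite !(ghostE _ nn) big_nat_cond [RHS]big_nat_cond.
    apply: eq_bigr => d /andP[/andP[d0 dn] _]; rewrite /wcomp /=.
    rewrite ifT //; case: d d0 dn => // d _; rewrite ltnS => dn.
    by have := leq_ltn_trans dn npn; rewrite -{1}(prednK n0) ltnS.
  have := gC p n pp pn n0; have := ghost_congP b pp pn n0.
  rewrite bn bnp => /nat_dvdN H1 /(nat_dvdD H1).
  by rewrite opprB addrC subrKA.
move=> zE.
rewrite aE /nxt; rewrite (partE _ (wcoef a)) ?zE ?subrKC //.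
by move=> i ilt; rewrite fa.
Qed.

Lemma ghost_congD g h : ghost_cong g -> ghost_cong h ->
  ghost_cong (fun n => g n + h n).
Proof.
move=> gC hC p n pp pn n0; rewrite rmorphD opprD addrACA.
by apply: nat_dvdD; [apply: gC | apply: hC].
Qed.

Lemma ghost_congN g : ghost_cong g -> ghost_cong (fun n => - g n).
Proof.
by move=> gC p n pp pn n0; rewrite rmorphN -opprD; apply/nat_dvdN/gC.
Qed.

Lemma ghost_congM g h : ghost_cong g -> ghost_cong h ->
  ghost_cong (fun n => g n * h n).
Proof.
move=> gC hC p n pp pn n0; rewrite rmorphM.
rewrite -(subrKA (frob p (g (n %/ p)%N) * h n)) -mulrBl -mulrBr.
by apply: nat_dvdD; [apply/nat_dvdMr/gC | apply/nat_dvdMl/hC].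
Qed.

End Dwork.

Section IPolyDwork.
Variable I : choiceType.
Import monalg.

Lemma ipoly_tf n (x : ipoly I) : (0 < n)%N -> x *+ n = 0 -> x = 0.
Proof.
move=> n0 e; apply/malgP => k; have := congr1 (mcoeff k) e.
rewrite mcoeffMn mcoeff0 -mulr_natr => /eqP; rewrite mulf_eq0 => /orP[/eqP //|].
by rewrite natz eqz_nat; case: n n0 {e}.
Qed.

Definition ipoly_frob (p : nat) : {rmorphism ipoly I -> ipoly I} :=
  ipoly_eval (fun i : I => ivar i ^+ p).

Lemma ipoly_dvd_part n (x : ipoly I) : (0 < n)%N ->
  (forall p, prime p -> (p %| n)%N -> nat_dvd (p ^ logn p n) x) -> nat_dvd n x.
Proof.
move=> n0 H; apply: ipoly_dvd => k; rewrite /dvdz /=.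
apply/(dvdn_partP _ n0) => p; rewrite mem_primes => /and3P[pp _ pn].
by rewrite p_part; have [h e] := H p pp pn; have := ipoly_dvd_coef k e.
Qed.

End IPolyDwork.

Lemma addKBB (V : zmodType) (a b c : V) : a + b + c - a - c = b.
Proof. by rewrite -addrA -opprD opprD addrACA subrr addr0 [a + b]addrC addrK. Qed.

Lemma addBBBB (V : zmodType) (a b c d e : V) :
  a - b + (c - d) - (e - b - d) = a + c - e.
Proof.
by rewrite addrACA -opprD -[e - b - d]addrA -opprD opprB addrA subrK.
Qed.

Section FrobeniusLift.
Variables (A : comPzRingType) (phi : {rmorphism A -> A}) (p : nat).
Hypothesis pp : prime p.

Definition frob_at (g : A) := nat_dvd p (phi g - g ^+ p).

Lemma nat_dvd_exprD (g h : A) : nat_dvd p ((g + h) ^+ p - g ^+ p - h ^+ p).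
Proof.
rewrite exprDn -(big_mkord xpredT (fun i => g ^+ (p - i) * h ^+ i *+ 'C(p, i))).
have p0 := prime_gt0 pp.
rewrite big_nat_recr //= big_ltn //= bin0 binn subn0 subnn !expr0 mulr1 mul1r !mulr1n.
rewrite addKBB big_nat_cond.
apply: nat_dvd_sum => i /andP[/andP[i0 ip] _].
have ip' : (0 < i < p)%N by rewrite i0 ip.
apply: nat_dvd_trans (prime_dvd_bin pp ip') _.
by exists (g ^+ (p - i) * h ^+ i).
Qed.

Lemma frob_atD g h : frob_at g -> frob_at h -> frob_at (g + h).
Proof.
move=> Pg Ph; rewrite /frob_at rmorphD.
have := nat_dvdD (nat_dvdD Pg Ph) (nat_dvdN (nat_dvd_exprD g h)).
by rewrite addBBBB.
Qed.

Lemma frob_at0 : frob_at 0.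
Proof.
rewrite /frob_at rmorph0 expr0n -[p == _]negbK -lt0n prime_gt0 //= subr0.
exact: nat_dvd0.
Qed.

Lemma frob_atN g : frob_at g -> frob_at (- g).
Proof.
move=> Pg; rewrite /frob_at rmorphN.
have := nat_dvdD (nat_dvdN Pg) (nat_dvd_exprD g (- g)).
rewrite subrr expr0n -[p == _]negbK -lt0n prime_gt0 //= sub0r opprB addrA.
by rewrite [_ - phi g - _]addrAC subrr add0r.
Qed.

Lemma frob_at1 : frob_at 1.
Proof. by rewrite /frob_at rmorph1 expr1n subrr; apply: nat_dvd0. Qed.

Lemma frob_atM g h : frob_at g -> frob_at h -> frob_at (g * h).
Proof.
move=> Pg Ph; rewrite /frob_at rmorphM exprMn.
rewrite -(subrKA (g ^+ p * phi h)) -mulrBl -mulrBr.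
by apply: nat_dvdD; [apply: nat_dvdMr | apply: nat_dvdMl].
Qed.

Lemma frob_atX g n : frob_at g -> frob_at (g ^+ n).
Proof.
move=> Pg; elim: n => [|n IH]; rewrite ?expr0 ?exprS; first exact: frob_at1.
exact: frob_atM.
Qed.

Lemma frob_atMz g (c : int) : frob_at g -> frob_at (g *~ c).
Proof.
move=> Pg; case: c => j; rewrite ?NegzE ?mulrNz -pmulrn; last apply: frob_atN.
  by elim: j => [|j IH]; rewrite ?mulr0n ?mulrS; [apply: frob_at0 | apply: frob_atD].
by elim: j => [|j IH]; rewrite ?mulr1n // mulrS; apply: frob_atD.
Qed.

Lemma frob_at_ipoly (I : choiceType) (v : I -> A) x :
  (forall i, phi (v i) = v i ^+ p) -> frob_at (ipoly_eval v x).
Proof.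
move=> vE; apply: big_ind => [|g h|k _]; [exact: frob_at0 | exact: frob_atD |].
apply: frob_atMz; apply: big_ind => [|g h|i _]; [exact: frob_at1 | exact: frob_atM |].
by apply: frob_atX; rewrite /frob_at vE subrr; apply: nat_dvd0.
Qed.

End FrobeniusLift.

Lemma ipoly_frobP (I : choiceType) p (x : ipoly I) :
  prime p -> nat_dvd p (ipoly_frob I p x - x ^+ p).
Proof.
move=> pp; rewrite -{2}(ipoly_eval_id x) -[in ipoly_frob I p x](ipoly_eval_id x).
by apply: frob_at_ipoly => // i; rewrite /ipoly_frob /= ipoly_eval_var.
Qed.

Section GhostMap.
Variables (U A : comPzRingType) (f : {rmorphism U -> A}) (n : nat).

Lemma ghost_wmapD (x y s : witt U) a b : ghost n s = ghost n x + ghost n y ->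
  witt_map f x = a -> witt_map f y = b -> ghost n (witt_map f s) = ghost n a + ghost n b.
Proof. by move=> e <- <-; rewrite !ghost_wmap e rmorphD. Qed.

Lemma ghost_wmapM (x y s : witt U) a b : ghost n s = ghost n x * ghost n y ->
  witt_map f x = a -> witt_map f y = b -> ghost n (witt_map f s) = ghost n a * ghost n b.
Proof. by move=> e <- <-; rewrite !ghost_wmap e rmorphM. Qed.

Lemma ghost_wmapN (x s : witt U) a : ghost n s = - ghost n x ->
  witt_map f x = a -> ghost n (witt_map f s) = - ghost n a.
Proof. by move=> e <-; rewrite !ghost_wmap e rmorphN. Qed.

End GhostMap.

Section WittPolynomials.

Let U : comPzRingType := ipoly (bool * nat)%type.

Definition wittX : witt U := Witt (fun i => ivar (false, i)).
Definition wittY : witt U := Witt (fun i => ivar (true, i)).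

(* The vector over Z[x_1, x_2, ..., y_1, y_2, ...] whose ghost components are g. *)
Definition witt_poly (g : nat -> U) : witt U :=
  xget wittX (fun s => forall n, (0 < n)%N -> ghost n s = g n).

Definition wadd_poly := witt_poly (fun n => ghost n wittX + ghost n wittY).
Definition wmul_poly := witt_poly (fun n => ghost n wittX * ghost n wittY).
Definition wopp_poly := witt_poly (fun n => - ghost n wittX).

Let ghost_cong_U := ghost_cong (@ipoly_frob (bool * nat)%type).

Lemma ghost_witt_poly g n : ghost_cong_U g -> (0 < n)%N ->
  ghost n (witt_poly g) = g n.
Proof.
move=> gC; have ex := dwork (@ipoly_frobP _) (@ipoly_dvd_part _) gC.
exact: (xgetPex wittX ex n).
Qed.

Let cong_ghost (a : witt U) : ghost_cong_U (fun n => ghost n a).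
Proof. exact: ghost_congP (@ipoly_frobP _) a. Qed.

Lemma ghost_wadd_poly n : (0 < n)%N ->
  ghost n wadd_poly = ghost n wittX + ghost n wittY.
Proof. by apply: ghost_witt_poly; apply: ghost_congD; apply: cong_ghost. Qed.

Lemma ghost_wmul_poly n : (0 < n)%N ->
  ghost n wmul_poly = ghost n wittX * ghost n wittY.
Proof. by apply: ghost_witt_poly; apply: ghost_congM; apply: cong_ghost. Qed.

Lemma ghost_wopp_poly n : (0 < n)%N -> ghost n wopp_poly = - ghost n wittX.
Proof. by apply: ghost_witt_poly; apply: ghost_congN; apply: cong_ghost. Qed.

End WittPolynomials.

(* The operations of W(A) substitute the components of a and b into the universal
   polynomials s such that w_n(s) = w_n(x) + w_n(y) (resp. w_n(x) w_n(y),
   - w_n(x)) for all n >= 1.  By [ghost_rmorph] and [witt_map_rmorph] below, this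
   is the functorial ring structure for which the w_n are ring morphisms. *)
Definition pair_val (A : Type) (a b : witt A) (k : bool * nat) : A :=
  if k.1 then wcoef b k.2 else wcoef a k.2.

Definition wzero (A : comPzRingType) : witt A := Witt (fun=> 0).
Definition wone (A : comPzRingType) : witt A := Witt (fun i => (i == 0%N)%:R).

HB.lock Definition wadd (A : comPzRingType) (a b : witt A) : witt A :=
  witt_map (ipoly_eval (pair_val a b)) wadd_poly.
HB.lock Definition wmul (A : comPzRingType) (a b : witt A) : witt A :=
  witt_map (ipoly_eval (pair_val a b)) wmul_poly.
HB.lock Definition wopp (A : comPzRingType) (a : witt A) : witt A :=
  witt_map (ipoly_eval (pair_val a a)) wopp_poly.

Section WittOperations.
Variable A : comPzRingType.
Implicit Types a b c : witt A.

Let evX a b : witt_map (ipoly_eval (pair_val a b)) wittX = a.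
Proof. by apply: wittP => i; rewrite /= ipoly_eval_var. Qed.
Let evY a b : witt_map (ipoly_eval (pair_val a b)) wittY = b.
Proof. by apply: wittP => i; rewrite /= ipoly_eval_var. Qed.

Lemma ghost_wadd n a b : (0 < n)%N -> ghost n (wadd a b) = ghost n a + ghost n b.
Proof.
rewrite wadd.unlock => n0.
exact: (ghost_wmapD (f := ipoly_eval (pair_val a b)) (ghost_wadd_poly n0) (evX a b) (evY a b)).
Qed.

Lemma ghost_wmul n a b : (0 < n)%N -> ghost n (wmul a b) = ghost n a * ghost n b.
Proof.
rewrite wmul.unlock => n0.
exact: (ghost_wmapM (f := ipoly_eval (pair_val a b)) (ghost_wmul_poly n0) (evX a b) (evY a b)).
Qed.

Lemma ghost_wopp n a : (0 < n)%N -> ghost n (wopp a) = - ghost n a.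
Proof.
rewrite wopp.unlock => n0.
exact: (ghost_wmapN (f := ipoly_eval (pair_val a a)) (ghost_wopp_poly n0) (evX a a)).
Qed.

Lemma ghost_wzero n : (0 < n)%N -> ghost n (wzero A) = 0.
Proof.
move=> n0; rewrite /ghost big_seq big1 // => d; rewrite -dvdn_divisors // => dn.
by rewrite expr0n -[_ == _]negbK -lt0n divn_gt0 ?(dvdn_gt0 n0 dn) // dvdn_leq // mul0rn.
Qed.

Lemma ghost_wone n : (0 < n)%N -> ghost n (wone A) = 1.
Proof.
move=> n0; have nn : (0 < n <= n)%N by rewrite n0 leqnn.
rewrite (ghostE _ nn) big_mkcond big_ltn // dvd1n big_nat_cond.
rewrite /=; set r := (X in _ + X); have -> : r = 0; last first.
  by rewrite addr0 /wcomp /= expr1n mulr1n.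
apply: big1 => -[|[|d]] // /andP[/andP[_ dn] _]; case: ifP => // ddn.
rewrite /wcomp /= expr0n -[_ == _]negbK -lt0n divn_gt0 //.
by rewrite dvdn_leq // mul0rn.
Qed.

End WittOperations.

Lemma witt_map_wadd (A B : comPzRingType) (f : {rmorphism A -> B}) a b :
  witt_map f (wadd a b) = wadd (witt_map f a) (witt_map f b).
Proof.
rewrite wadd.unlock; apply: wittP => i; rewrite /= ipoly_eval_comp.
by congr ipoly_eval; apply/funext => -[[] j].
Qed.

Lemma witt_map_wmul (A B : comPzRingType) (f : {rmorphism A -> B}) a b :
  witt_map f (wmul a b) = wmul (witt_map f a) (witt_map f b).
Proof.
rewrite wmul.unlock; apply: wittP => i; rewrite /= ipoly_eval_comp.
by congr ipoly_eval; apply/funext => -[[] j].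
Qed.

Lemma witt_map_wopp (A B : comPzRingType) (f : {rmorphism A -> B}) a :
  witt_map f (wopp a) = wopp (witt_map f a).
Proof.
rewrite wopp.unlock; apply: wittP => i; rewrite /= ipoly_eval_comp.
by congr ipoly_eval; apply/funext => -[[] j].
Qed.

Lemma witt_map_wzero (A B : comPzRingType) (f : {rmorphism A -> B}) :
  witt_map f (wzero A) = wzero B.
Proof. by apply: wittP => i; rewrite /= rmorph0. Qed.

Lemma witt_map_wone (A B : comPzRingType) (f : {rmorphism A -> B}) :
  witt_map f (wone A) = wone B.
Proof. by apply: wittP => i; rewrite /= rmorph_nat. Qed.

Section WittRingCover.
Variables (F A : comPzRingType) (ev : {rmorphism F -> A}).
Variable lift : witt A -> witt F.
Hypothesis liftK : forall a, a = witt_map ev (lift a).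
Hypothesis inj : forall a b : witt F,
  (forall n, (0 < n)%N -> ghost n a = ghost n b) -> a = b.

Lemma cover_waddA : associative (@wadd A).
Proof.
move=> a b c; rewrite (liftK a) (liftK b) (liftK c) -!witt_map_wadd.
by congr (witt_map ev); apply: inj => n n0; rewrite !ghost_wadd // addrA.
Qed.

Lemma cover_waddC : commutative (@wadd A).
Proof.
move=> a b; rewrite (liftK a) (liftK b) -!witt_map_wadd.
by congr (witt_map ev); apply: inj => n n0; rewrite !ghost_wadd // addrC.
Qed.

Lemma cover_wadd0 : left_id (wzero A) (@wadd A).
Proof.
move=> a; rewrite [RHS](liftK a) {1}(liftK a) -(witt_map_wzero ev) -witt_map_wadd.
by congr (witt_map ev); apply: inj => n n0; rewrite ghost_wadd // ghost_wzero // add0r.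
Qed.

Lemma cover_waddN : left_inverse (wzero A) (@wopp A) (@wadd A).
Proof.
move=> a; rewrite (liftK a) -(witt_map_wzero ev) -witt_map_wopp -witt_map_wadd.
congr (witt_map ev); apply: inj => n n0.
by rewrite ghost_wadd // ghost_wopp // ghost_wzero // addNr.
Qed.

Lemma cover_wmulA : associative (@wmul A).
Proof.
move=> a b c; rewrite (liftK a) (liftK b) (liftK c) -!witt_map_wmul.
by congr (witt_map ev); apply: inj => n n0; rewrite !ghost_wmul // mulrA.
Qed.

Lemma cover_wmulC : commutative (@wmul A).
Proof.
move=> a b; rewrite (liftK a) (liftK b) -!witt_map_wmul.
by congr (witt_map ev); apply: inj => n n0; rewrite !ghost_wmul // mulrC.
Qed.

Lemma cover_wmul1 : left_id (wone A) (@wmul A).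
Proof.
move=> a; rewrite [RHS](liftK a) {1}(liftK a) -(witt_map_wone ev) -witt_map_wmul.
by congr (witt_map ev); apply: inj => n n0; rewrite ghost_wmul // ghost_wone // mul1r.
Qed.

Lemma cover_wmulDl : left_distributive (@wmul A) (@wadd A).
Proof.
move=> a b c; rewrite (liftK a) (liftK b) (liftK c).
rewrite -!witt_map_wmul -!witt_map_wadd -witt_map_wmul.
congr (witt_map ev); apply: inj => n n0.
by rewrite !(ghost_wadd, ghost_wmul) // mulrDl.
Qed.

End WittRingCover.

Section WittRing.
Variable A : comPzRingType.

Let F : comPzRingType := ipoly A.
Let ev : {rmorphism F -> A} := ipoly_eval (fun x : A => x).
Let lift (a : witt A) : witt F := Witt (fun i => ivar (wcoef a i)).

Let liftK a : a = witt_map ev (lift a).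
Proof. by apply: wittP => i; rewrite /= /ev /= ipoly_eval_var. Qed.

Let inj := ghost_inj (@ipoly_tf A).

Lemma waddA : associative (@wadd A). Proof. exact: (cover_waddA liftK inj). Qed.
Lemma waddC : commutative (@wadd A). Proof. exact: (cover_waddC liftK inj). Qed.
Lemma wadd0 : left_id (wzero A) (@wadd A).
Proof. exact: (cover_wadd0 liftK inj). Qed.
Lemma waddN : left_inverse (wzero A) (@wopp A) (@wadd A).
Proof. exact: (cover_waddN liftK inj). Qed.
Lemma wmulA : associative (@wmul A). Proof. exact: (cover_wmulA liftK inj). Qed.
Lemma wmulC : commutative (@wmul A). Proof. exact: (cover_wmulC liftK inj). Qed.
Lemma wmul1 : left_id (wone A) (@wmul A).
Proof. exact: (cover_wmul1 liftK inj). Qed.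
Lemma wmulDl : left_distributive (@wmul A) (@wadd A).
Proof. exact: (cover_wmulDl liftK inj). Qed.

End WittRing.

HB.instance Definition _ (A : comPzRingType) :=
  GRing.isZmodule.Build (witt A) (@waddA A) (@waddC A) (@wadd0 A) (@waddN A).

HB.instance Definition _ (A : comPzRingType) :=
  GRing.Zmodule_isComPzRing.Build (witt A)
    (@wmulA A) (@wmulC A) (@wmul1 A) (@wmulDl A).

Lemma ghost_rmorph (A : comPzRingType) n : (0 < n)%N ->
  zmod_morphism (@ghost A n) /\ monoid_morphism (@ghost A n).
Proof.
move=> n0; split=> [a b|].
  have -> : a - b = wadd a (wopp b) by [].
  by rewrite ghost_wadd // ghost_wopp.
by split=> [|a b]; [apply: ghost_wone | apply: ghost_wmul].
Qed.

Lemma witt_map_rmorph (A B : comPzRingType) (f : {rmorphism A -> B}) :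
  zmod_morphism (witt_map f) /\ monoid_morphism (witt_map f).
Proof.
split=> [a b|].
  have -> : a - b = wadd a (wopp b) by [].
  by rewrite witt_map_wadd witt_map_wopp.
by split=> [|a b]; [apply: witt_map_wone | apply: witt_map_wmul].
Qed.

Section UniversalPolynomials.
Import mpoly.

(* Elementary symmetric function of degree k of the variables 'X_(x i). *)
Definition elem_sym (n N : nat) (x : 'I_n -> 'I_N) (k : nat) : {mpoly int[N]} :=
  \sum_(h : {set 'I_n} | #|h| == k) \prod_(i in h) 'X_(x i).

(* P_n: the polynomial whose value at the elementary symmetric functions of
   x_1, ..., x_n and of y_1, ..., y_n is the coefficient of t^n in
   prod_(i, j) (1 + x_i y_j t).  The first n of the n + n variables of P_n stand
   for the symmetric functions of the x_i. *)
Definition Pprod (n : nat) : {mpoly int[n + n]} :=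
  xget 0 (fun p : {mpoly int[n + n]} =>
    p \mPo [tuple match fintype.split k with
                  | inl i => elem_sym (lshift n) i.+1
                  | inr j => elem_sym (@rshift n n) j.+1
                  end | k < n + n]
    = (\prod_(i < n) \prod_(j < n)
         (1 + ('X_(lshift n i) * 'X_(rshift n j)) *: 'X))`_n).

(* P_(m,n): the polynomial whose value at the elementary symmetric functions of
   x_1, ..., x_(mn) is the coefficient of t^m in
   prod_(i_1 < ... < i_n) (1 + x_(i_1) ... x_(i_n) t). *)
Definition Pcomp (m n : nat) : {mpoly int[m * n]} :=
  xget 0 (fun p : {mpoly int[m * n]} =>
    p \mPo [tuple elem_sym id k.+1 | k < m * n]
    = (\prod_(h : {set 'I_(m * n)} | #|h| == n)
         (1 + (\prod_(i in h) 'X_i) *: 'X))`_m).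

Definition zeval (n : nat) (A : comPzRingType) (p : {mpoly int[n]})
    (v : 'I_n -> A) : A :=
  \sum_(m <- msupp p) (\prod_(i < n) v i ^+ m i) *~ p@_m.

End UniversalPolynomials.

(* P_n(a_1, ..., a_n; b_1, ..., b_n) and P_(m,n)(a_1, ..., a_(mn)); the values
   a 0 and b 0 are not used. *)
Definition Pprod_eval (A : comPzRingType) (n : nat) (a b : nat -> A) : A :=
  zeval (Pprod n) (fun k => match fintype.split k with
                            | inl i => a i.+1
                            | inr j => b j.+1
                            end).

Definition Pcomp_eval (A : comPzRingType) (m n : nat) (a : nat -> A) : A :=
  zeval (Pcomp m n) (fun k => a k.+1).

Record is_lambda_ring (A : comPzRingType) (L : nat -> A -> A) : Prop := {
  lambda0 : forall r, L 0%N r = 1;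
  lambda1 : forall r, L 1%N r = r;
  lambda_one : forall n, (1 < n)%N -> L n 1 = 0;
  lambdaD : forall n r s,
    L n (r + s) = \sum_(i < n.+1) L i r * L (n - i)%N s;
  lambdaM : forall n r s,
    L n (r * s) = Pprod_eval n (fun i => L i r) (fun i => L i s);
  lambda_comp : forall m n r, L m (L n r) = Pcomp_eval m n (fun i => L i r)
}.

(* [LambdaSeries c] is the power series 1 + sum_(k >= 0) c_k t^(k+1); [lser] gives
   its coefficients, indexed by the degree. *)
Record Lambda (A : Type) := LambdaSeries { lambda_coef : nat -> A }.

Section LambdaSeries.
Variable A : comPzRingType.
Implicit Types f g : Lambda A.

Definition lser f (n : nat) : A := if n is k.+1 then lambda_coef f k else 1.

Definition ser_mul (u v : nat -> A) (n : nat) : A :=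
  \sum_(i < n.+1) u i * v (n - i)%N.

Definition Lambda_one : Lambda A := LambdaSeries (fun k => (k == 0%N)%:R).
Definition Lambda_add f g : Lambda A := LambdaSeries (fun k => ser_mul (lser f) (lser g) k.+1).
Definition Lambda_mul f g : Lambda A :=
  LambdaSeries (fun k => Pprod_eval k.+1 (lser f) (lser g)).

Definition Lambda_lambda (i : nat) f : Lambda A :=
  if i == 0%N then Lambda_one else LambdaSeries (fun k => Pcomp_eval k.+1 i (lser f)).

Definition Lambda_t f : Lambda (Lambda A) := LambdaSeries (fun k => Lambda_lambda k.+1 f).

(* The power series 1 - a_i (- t)^i. *)
Definition exp_factor (a : witt A) (i n : nat) : A :=
  (n == 0%N)%:R - (wcomp a i * (- 1) ^+ i) *+ (n == i).

Definition ser_one (n : nat) : A := (n == 0%N)%:R.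

(* The factors with i > n do not contribute to the coefficient of t^n in
   prod_(i >= 1) (1 - a_i (- t)^i). *)
Definition witt_exp (a : witt A) : Lambda A :=
  LambdaSeries (fun k =>
    (\big[ser_mul/ser_one]_(1 <= i < k.+2) exp_factor a i) k.+1).

Definition witt_exp_inv f : witt A := xget 0 (fun a => witt_exp a = f).

End LambdaSeries.

Definition Lambda_map (A B : Type) (h : A -> B) (f : Lambda A) : Lambda B :=
  LambdaSeries (fun k => h (lambda_coef f k)).

(* E^2 = (Lambda E) o E, W(W(A)) -> Lambda(W(A)) -> Lambda(Lambda(A)). *)
Definition witt_exp2 (A : comPzRingType) (b : witt (witt A)) : Lambda (Lambda A) :=
  Lambda_map (@witt_exp A) (witt_exp b).

Definition witt_counit (A : comPzRingType) (a : witt A) : A :=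
  lambda_coef (witt_exp a) 0.

(* (E^2)^-1 o Lambda_t o E *)
Definition witt_comult (A : comPzRingType) (a : witt A) : witt (witt A) :=
  xget 0 (fun b => witt_exp2 b = Lambda_t (witt_exp a)).

Definition witt_lambda (A : comPzRingType) (i : nat) (a : witt A) : witt A :=
  witt_exp_inv (Lambda_lambda i (witt_exp a)).

Definition lambda_t (A : comPzRingType) (L : nat -> A -> A) (r : A) : Lambda A :=
  LambdaSeries (fun k => L k.+1 r).

Local Open Scope classical_set_scope.

Record is_ideal (A : comPzRingType) (J : set A) : Prop := {
  ideal0 : J 0;
  idealD : forall x y, J x -> J y -> J (x + y);
  idealM : forall a x, J x -> J (a * x)
}.

Record is_filtration (A : comPzRingType) (J : nat -> set A) : Prop := {
  fil_ideal : forall n, is_ideal (J n);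
  fil0 : J 0%N = setT;
  fil_dec : forall n, J n.+1 `<=` J n;
  filM : forall n m x y, J n x -> J m y -> J (n + m)%N (x * y)
}.

Record filtRing := FiltRing {
  fring :> comPzRingType;
  fil : nat -> set fring;
  filP : is_filtration fil
}.
Arguments fil : clear implicits.

Definition is_filt_hom (X Y : filtRing) (f : X -> Y) : Prop :=
  [/\ zmod_morphism f, monoid_morphism f &
      forall n x, fil X n x -> fil Y n (f x)].

Record filtHom (X Y : filtRing) := FiltHom {
  fhom :> X -> Y;
  fhomP : is_filt_hom fhom
}.

Lemma filtHom_ext (X Y : filtRing) (f g : filtHom X Y) : f =1 g -> f = g.
Proof.
case: f g => [f fP] [g gP] /= /funext e; move: fP gP; rewrite e => fP gP.
by congr FiltHom; apply: Prop_irrelevance.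
Qed.

Lemma is_filt_hom_id (X : filtRing) : is_filt_hom (fun x : X => x).
Proof. by split=> //; split. Qed.

Lemma is_filt_hom_comp (X Y Z : filtRing) (g : filtHom Y Z) (f : filtHom X Y) :
  is_filt_hom (fun x => g (f x)).
Proof.
have [gB [g1 gM] gF] := fhomP g; have [fB [f1 fM] fF] := fhomP f.
split=> [x y|| n x /fF /gF //]; first by rewrite fB gB.
by split=> [|x y]; rewrite ?f1 // fM gM.
Qed.

Definition filt_id (X : filtRing) : filtHom X X := FiltHom (is_filt_hom_id X).
Definition filt_comp (X Y Z : filtRing) (g : filtHom Y Z) (f : filtHom X Y) :
  filtHom X Z := FiltHom (is_filt_hom_comp g f).

Record category := Category {
  obj :> Type;
  arrow : obj -> obj -> Type;
  identity : forall X, arrow X X;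
  compose : forall X Y Z, arrow Y Z -> arrow X Y -> arrow X Z;
  compose1m : forall X Y (f : arrow X Y), compose (identity Y) f = f;
  composem1 : forall X Y (f : arrow X Y), compose f (identity X) = f;
  composeA : forall X Y Z T (h : arrow Z T) (g : arrow Y Z) (f : arrow X Y),
    compose h (compose g f) = compose (compose h g) f
}.
Arguments identity {c} X.
Arguments compose {c X Y Z} g f.

Record functor_data (C : category) := FunctorData {
  fobj :> C -> C;
  fmor : forall X Y, arrow X Y -> arrow (fobj X) (fobj Y)
}.
Arguments fmor {C} f {X Y} g.

Record is_functor (C : category) (F : functor_data C) : Prop := {
  fmor1 : forall X, fmor F (identity X) = identity (F X);
  fmorM : forall X Y Z (g : arrow Y Z) (f : arrow X Y),
    fmor F (compose g f) = compose (fmor F g) (fmor F f)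
}.

Record is_comonad (C : category) (F : functor_data C)
    (eta : forall X, arrow (F X) X) (mu : forall X, arrow (F X) (F (F X))) : Prop := {
  comonad_functor : is_functor F;
  eta_natural : forall X Y (f : arrow X Y),
    compose f (eta X) = compose (eta Y) (fmor F f);
  mu_natural : forall X Y (f : arrow X Y),
    compose (fmor F (fmor F f)) (mu X) = compose (mu Y) (fmor F f);
  comonad_counitl : forall X, compose (fmor F (eta X)) (mu X) = identity (F X);
  comonad_counitr : forall X, compose (eta (F X)) (mu X) = identity (F X);
  comonad_coassoc : forall X,
    compose (fmor F (mu X)) (mu X) = compose (mu (F X)) (mu X)
}.

Definition is_coalgebra (C : category) (F : functor_data C)
    (eta : forall X, arrow (F X) X) (mu : forall X, arrow (F X) (F (F X)))
    (X : C) (xi : arrow X (F X)) : Prop :=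
  compose (fmor F xi) xi = compose (mu X) xi /\ compose (eta X) xi = identity X.

Lemma filt_comp1m X Y (f : filtHom X Y) : filt_comp (filt_id Y) f = f.
Proof. exact: filtHom_ext. Qed.
Lemma filt_compm1 X Y (f : filtHom X Y) : filt_comp f (filt_id X) = f.
Proof. exact: filtHom_ext. Qed.
Lemma filt_compA X Y Z T (h : filtHom Z T) (g : filtHom Y Z) (f : filtHom X Y) :
  filt_comp h (filt_comp g f) = filt_comp (filt_comp h g) f.
Proof. exact: filtHom_ext. Qed.

Definition filtRingCat : category := Category filt_comp1m filt_compm1 filt_compA.

Definition witt_fil (X : filtRing) (n : nat) : set (witt X) :=
  [set a | forall i, fil X n (wcoef a i)].

Section WittFunctor.
Hypothesis obP : forall X : filtRing, is_filtration (@witt_fil X).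

Definition witt_filt (X : filtRing) : filtRing := FiltRing (obP X).

Hypothesis morP : forall (X Y : filtRing) (f : filtHom X Y),
  @is_filt_hom (witt_filt X) (witt_filt Y) (witt_map f).

Definition witt_functor : functor_data filtRingCat :=
  @FunctorData filtRingCat witt_filt (fun X Y (f : filtHom X Y) => FiltHom (morP f)).

End WittFunctor.

Definition is_filt_lambda (X : filtRing) (L : nat -> X -> X) : Prop :=
  is_lambda_ring L /\
  forall n i x, (0 < i)%N -> fil X n x -> fil X n (L i x).

Definition filt_lambda (X : filtRing) : Type :=
  {L : nat -> X -> X | is_filt_lambda L}.
HB.instance Definition _ (X : filtRing) := gen_eqMixin (filt_lambda X).
HB.instance Definition _ (X : filtRing) := gen_choiceMixin (filt_lambda X).

Section FiltrationTopology.
Variable X : filtRing.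

(* R / I^n is the set of the cosets x + I^n, and the transition map
   R / I^(n+1) -> R / I^n sends x + I^(n+1) to x + I^n. *)
Definition fil_coset (n : nat) (x : X) : set X := [set y | fil X n (y - x)].

Definition fil_limit : Type :=
  {s : nat -> set X | forall n, exists x,
     s n.+1 = fil_coset n.+1 x /\ s n = fil_coset n x}.

Definition to_fil_limit (x : X) : fil_limit :=
  exist _ (fil_coset^~ x) (fun n => ex_intro _ x (conj erefl erefl)).

Definition fil_complete : Prop := forall s : fil_limit, exists x, to_fil_limit x = s.
Definition fil_hausdorff : Prop := injective to_fil_limit.

Definition filt_space : Type := X.
HB.instance Definition _ := Choice.on filt_space.

(* The topology with basis the cosets x + I^n. *)
Definition filt_open (U : set filt_space) : Prop :=
  forall x, U x -> exists n, fil_coset n x `<=` U.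

Lemma fil_le n m : (n <= m)%N -> fil X m `<=` fil X n.
Proof.
move=> /subnK <-; elim: (m - n)%N => //= k IH x.
by move/(fil_dec (filP X)); apply: IH.
Qed.

Lemma filt_openT : filt_open setT.
Proof. by move=> x _; exists 0%N. Qed.

Lemma filt_openI : setI_closed filt_open.
Proof.
move=> U V Uo Vo x [/Uo [n nU] /Vo [m mV]]; exists (maxn n m) => y xy; split.
  by apply: nU; apply: fil_le xy; apply: leq_maxl.
by apply: mV; apply: fil_le xy; apply: leq_maxr.
Qed.

Lemma filt_open_bigU (I : Type) (f : I -> set filt_space) :
  (forall i, filt_open (f i)) -> filt_open (\bigcup_i f i).
Proof.
move=> fo x [i _ /fo [n nf]]; exists n => y /nf fy; by exists i.
Qed.

HB.instance Definition _ :=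
  isOpenTopological.Build filt_space filt_openT filt_openI filt_open_bigU.

End FiltrationTopology.

(* Continuous maps, as a subspace of all maps with the compact-open topology. *)
Definition cts_space (U V : topologicalType) :=
  initial_topology (fun f : continuousType U V => (f : {compact-open, U -> V})).
HB.instance Definition _ (U V : topologicalType) :=
  Topological.on (cts_space U V).

Definition homeomorphism (U V : topologicalType) (f : U -> V) : Prop :=
  continuous f /\ exists g, [/\ cancel f g, cancel g f & continuous g].

(* Main.v *)
(* Over a torsion-free ring a Witt vector is determined by its ghost components w_n, and
   every ring A is a quotient of such a ring.  Through w_n, the exponential E satisfies
   t E(a)' = (sum_k (-1)^(k-1) w_k(a) t^k) E(a), so that E turns addition into
   multiplication of power series and the Teichmueller vector [x] into 1 + x t.

   Dwork's lemma over the polynomial ring U, and once more over W(U), yields a natural ring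
   morphism mu : W(A) -> W(W(A)) with w_n(w_m(mu a)) = w_(nm)(a).  The comonad laws for mu
   hold because they hold for ghost components.

   If E(a) = prod (1 + x_i t) and E(b) = prod (1 + y_j t), then ab = sum [x_i y_j] and
   mu(a) = sum [[x_i]], which gives the defining equations of P_n and P_(m,n).  Since
   elementary symmetric functions are algebraically independent, E(ab) is the product of
   E(a) and E(b) in Lambda(A), and E^2 mu = Lambda_t E.  The axioms of a lambda-ring for
   lambda_t thereby become those of a W-coalgebra for E^-1 lambda_t.

   The filtration W(I^n) is handled by congruences between values of polynomials. *)
From HB Require Import structures.
From mathcomp Require mpoly.
Require Import Defs.
From mathcomp Require Import all_boot all_order all_algebra.
From mathcomp Require Import all_classical topology.

Set Implicit Arguments.
Unset Strict Implicit.
Unset Printing Implicit Defensive.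

Import GRing.Theory.
Local Open Scope classical_set_scope.
Local Open Scope ring_scope.

(** * Power series *)

(** The ring structure put on this record has [ser_mul] as its product, so that the fold in
    [witt_exp] becomes a product in a commutative ring. *)
Record series (A : Type) := Series { coefs : nat -> A }.

HB.instance Definition _ (A : Type) := gen_eqMixin (series A).
HB.instance Definition _ (A : Type) := gen_choiceMixin (series A).

Lemma seriesP (A : Type) (u v : series A) : coefs u =1 coefs v -> u = v.
Proof. by case: u v => [u] [v] /= /funext ->. Qed.

Section SeriesRing.
Variable A : comPzRingType.
Implicit Types u v w : series A.

Definition sadd u v := Series (fun n => coefs u n + coefs v n).
Definition sopp u := Series (fun n => - coefs u n).
Definition szero : series A := Series (fun=> 0).
Definition smul u v := Series (ser_mul (coefs u) (coefs v)).
Definition sone : series A := Series (@ser_one A).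

Lemma saddA : associative sadd.
Proof. by move=> u v w; apply: seriesP => n; rewrite /= addrA. Qed.
Lemma saddC : commutative sadd.
Proof. by move=> u v; apply: seriesP => n; rewrite /= addrC. Qed.
Lemma sadd0 : left_id szero sadd.
Proof. by move=> u; apply: seriesP => n; rewrite /= add0r. Qed.
Lemma saddN : left_inverse szero sopp sadd.
Proof. by move=> u; apply: seriesP => n; rewrite /= addNr. Qed.

HB.instance Definition _ := GRing.isZmodule.Build (series A) saddA saddC sadd0 saddN.

Lemma smulC : commutative smul.
Proof.
move=> u v; apply: seriesP => n; rewrite /= /ser_mul (reindex_inj rev_ord_inj) /=.
by apply: eq_bigr => i _; rewrite mulrC subSS subKn // -ltnS.
Qed.

Lemma smulA : associative smul.
Proof.
move=> u v w; apply: seriesP => n; rewrite [in RHS]smulC /= /ser_mul.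
pose F i k := coefs u i * (coefs v (n - i - k) * coefs w k).
(* Both sides sum [F i k] over i + k <= n; after [smulC] the right side has k as its outer index. *)
transitivity (\sum_(i < n.+1) \sum_(k < n.+1 | (k <= n - i)%N) F i k).
  apply: eq_bigr => i _; rewrite (big_ord_narrow_leq (leq_subr _ _)) big_distrr.
  rewrite (reindex_inj rev_ord_inj); apply: eq_bigr => k _ /=.
  by rewrite subSS subKn // -ltnS.
rewrite (exchange_big_dep predT) //=; apply: eq_bigr => k _.
rewrite mulr_sumr (eq_bigl (fun i : 'I_n.+1 => i <= n - k)%N); last first.
  by move=> i; rewrite !leq_subRL ?leq_ord // addnC.
rewrite (big_ord_narrow_leq (leq_subr _ _)); apply: eq_bigr => i _ /=.
by rewrite /F mulrA [RHS]mulrC -!subnDA addnC.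
Qed.

Lemma smul1 : left_id sone smul.
Proof.
move=> u; apply: seriesP => n; rewrite /= /ser_mul big_ord_recl big1 ?addr0.
  by rewrite /= /ser_one mul1r subn0.
by move=> i _; rewrite /ser_one /= mul0r.
Qed.

Lemma smulDl : left_distributive smul sadd.
Proof.
move=> u v w; apply: seriesP => n; rewrite /= /ser_mul -big_split.
by apply: eq_bigr => i _; rewrite mulrDl.
Qed.

HB.instance Definition _ := GRing.Zmodule_isComPzRing.Build (series A)
  smulA smulC smul1 smulDl.

Lemma coefsM u v n : coefs (u * v) n = \sum_(i < n.+1) coefs u i * coefs v (n - i).
Proof. by []. Qed.

Lemma coefs1 n : coefs (1 : series A) n = (n == 0%N)%:R. Proof. by []. Qed.

Lemma coefsD u v n : coefs (u + v) n = coefs u n + coefs v n. Proof. by []. Qed.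

Lemma coefs_sum (I : Type) (r : seq I) (P : pred I) (F : I -> series A) n :
  coefs (\sum_(i <- r | P i) F i) n = \sum_(i <- r | P i) coefs (F i) n.
Proof. by apply: (big_morph (fun u => coefs u n)). Qed.

Definition smon (n : nat) (c : A) : series A := Series (fun k => c *+ (k == n)).

Lemma coefs_mulmon u n c k :
  coefs (smon n c * u) k = if (n <= k)%N then c * coefs u (k - n) else 0.
Proof.
rewrite coefsM; case: leqP => [le|lt]; last first.
  rewrite big1 // => i _ /=; case: eqP => [e|_]; last by rewrite mulr0n mul0r.
  by have := ltn_ord i; rewrite e ltnS leqNgt lt.
rewrite -ltnS in le; rewrite (bigD1 (Ordinal le)) //= eqxx mulr1n big1 ?addr0 //.
by move=> i /negbTE; rewrite -val_eqE /= => ->; rewrite mul0r.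
Qed.

Lemma smonM n m c d : smon n c * smon m d = smon (n + m) (c * d).
Proof.
apply: seriesP => k; rewrite coefs_mulmon /= mulrnAr; case: leqP => le.
  by rewrite -[k == (n + m)%N](eqn_add2l n) eqn_add2l -(eqn_add2r n) subnK // addnC.
by rewrite ltn_eqF // (leq_trans le) ?leq_addr.
Qed.

Lemma smon0 : smon 0 1 = 1. Proof. by []. Qed.

(** The derivation t d/dt, which preserves degrees. *)
Definition seuler u := Series (fun n => coefs u n *+ n).

Lemma seulerM u v : seuler (u * v) = seuler u * v + u * seuler v.
Proof.
apply: seriesP => n; rewrite /= /ser_mul -big_split -sumrMnl.
apply: eq_bigr => i _; rewrite /= mulrnAl mulrnAr -mulrnDr subnKC //.
by rewrite -ltnS.
Qed.

End SeriesRing.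

Definition smap (A B : Type) (f : A -> B) (u : series A) : series B :=
  Series (fun n => f (coefs u n)).

Lemma smapM (A B : comPzRingType) (f : {rmorphism A -> B}) u v :
  smap f (u * v) = smap f u * smap f v.
Proof.
apply: seriesP => n; rewrite coefsM /= rmorph_sum.
by apply: eq_bigr => i _; rewrite rmorphM.
Qed.

Lemma smap1 (A B : comPzRingType) (f : {rmorphism A -> B}) : smap f 1 = 1.
Proof. by apply: seriesP => n; rewrite /= rmorph_nat. Qed.

(** * The exponential map *)

(** The list [f n] holds the first n values. Since [G n] only reads indices below n, it cannot tell
    this list from the whole sequence. *)
Lemma course_of_values (A : Type) (x0 : A) (G : nat -> (nat -> A) -> A) :
  (forall n s s', (forall i, (i < n)%N -> s i = s' i) -> G n s = G n s') ->
  exists s, forall n, s n = G n s.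
Proof.
move=> loc; pose f := fix f n := if n is m.+1
  then rcons (f m) (G m (nth x0 (f m))) else [::].
have szf n : size (f n) = n by elim: n => //= n IH; rewrite size_rcons IH.
exists (fun n => nth x0 (f n.+1) n) => n.
rewrite {1}/f -/f nth_rcons szf ltnn eqxx; apply: loc => i.
elim: n => // n IH; rewrite ltnS leq_eqVlt => /orP[/eqP -> //|lt].
by rewrite {1}/f -/f nth_rcons szf lt IH.
Qed.

Definition lsr (A : comPzRingType) (f : Lambda A) : series A := Series (lser f).

Lemma LambdaP (A : comPzRingType) (f g : Lambda A) : lser f =1 lser g -> f = g.
Proof.
by case: f g => [f] [g] e; congr LambdaSeries; apply/funext => k; apply: (e k.+1).
Qed.

Lemma mulr_signK (A : comPzRingType) n :
  cancel (fun x : A => x * (- 1) ^+ n) (fun x => x * (- 1) ^+ n).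
Proof. by move=> x; rewrite -mulrA -expr2 sqrr_sign mulr1. Qed.

Section Exponential.
Variable A : comPzRingType.
Implicit Types (a b : witt A) (f : Lambda A).

Definition exp_fac a (i : nat) : series A := 1 - smon i (wcomp a i * (- 1) ^+ i).

Definition exp_trunc a n : series A := \prod_(1 <= i < n) exp_fac a i.

Lemma coefs_exp_fac u a i n : coefs (u * exp_fac a i) n =
  coefs u n - (if (i <= n)%N then wcomp a i * (- 1) ^+ i * coefs u (n - i) else 0).
Proof. by rewrite mulrBr mulr1 [u * smon _ _]mulrC -coefs_mulmon. Qed.

Lemma lser_exp_trunc0 a n : lser (witt_exp a) n = coefs (exp_trunc a n.+1) n.
Proof.
case: n => [|n]; first by rewrite /exp_trunc big_geq.
rewrite /exp_trunc -[LHS]/(coefs (Series (\big[@ser_mul A/@ser_one A]_(1 <= i < n.+2)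
  exp_factor a i)) n.+1).
by rewrite (big_morph (@Series A) (id1 := 1) (op1 := *%R)).
Qed.

Lemma exp_truncS a n : (0 < n)%N -> exp_trunc a n.+1 = exp_trunc a n * exp_fac a n.
Proof. by move=> n0; rewrite /exp_trunc big_nat_recr. Qed.

(** The factor of index m leaves all coefficients below t^m unchanged. *)
Lemma lser_exp_trunc a n m : (n < m)%N -> lser (witt_exp a) n = coefs (exp_trunc a m) n.
Proof.
elim: m => // m IH; rewrite ltnS leq_eqVlt => /orP[/eqP <-|lt].
  exact: lser_exp_trunc0.
have m0 := leq_ltn_trans (leq0n _) lt.
by rewrite exp_truncS // coefs_exp_fac ifN -?ltnNge // subr0 IH.
Qed.

Lemma exp_trunc_0 a n : coefs (exp_trunc a n) 0 = 1.
Proof.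
elim: n => [|[|n] IH]; try by rewrite /exp_trunc big_geq.
by rewrite exp_truncS // coefs_exp_fac subr0.
Qed.

(** E is triangular: up to sign, the coefficient of t^n is a_n plus an expression in a_1, ...,
    a_(n-1). Injectivity, surjectivity and the transfer of ideals all rest on this. *)
Lemma lser_exp a n : (0 < n)%N -> lser (witt_exp a) n =
  coefs (exp_trunc a n) n - wcomp a n * (- 1) ^+ n.
Proof.
move=> n0; rewrite lser_exp_trunc0 exp_truncS // coefs_exp_fac leqnn subnn.
by rewrite exp_trunc_0 mulr1.
Qed.

Lemma eq_exp_trunc a b n : (forall i, (i < n)%N -> wcoef a i = wcoef b i) ->
  exp_trunc a n.+1 = exp_trunc b n.+1.
Proof.
move=> e; rewrite /exp_trunc big_nat_cond [RHS]big_nat_cond.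
apply: eq_bigr => -[|i] // /andP[/andP[_ lt] _].
by rewrite /exp_fac /wcomp /= e.
Qed.

(** The bound n is kept because the locality of the coefficients of products and of the
    comultiplication is derived from it. *)
Lemma lser_exp_inj a b n :
  (forall k, (k <= n)%N -> lser (witt_exp a) k = lser (witt_exp b) k) ->
  forall i, (i < n)%N -> wcoef a i = wcoef b i.
Proof.
move=> e i; have [m] := ubnP i; elim: m i => // m IH i; rewrite ltnS => im lt.
have := e i.+1 lt; rewrite !lser_exp // (@eq_exp_trunc a b) => [|j ji]; last first.
  by apply: IH; [apply: leq_trans im | apply: ltn_trans lt].
by move/addrI/oppr_inj/(can_inj (mulr_signK _)).
Qed.

Lemma witt_exp_inj : injective (@witt_exp A).
Proof.
by move=> a b e; apply: wittP => i; apply: (@lser_exp_inj _ _ i.+1) => // k _; rewrite e.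
Qed.

Lemma witt_exp_surj f : exists a, witt_exp a = f.
Proof.
(* [G n] solves [lser_exp] for the component of index n + 1. *)
pose G n (s : nat -> A) :=
  (coefs (exp_trunc (Witt s) n.+1) n.+1 - lser f n.+1) * (- 1) ^+ n.+1.
have [|s sE] := @course_of_values A 0 G.
  by move=> n s s' e; rewrite /G (@eq_exp_trunc (Witt s) (Witt s')).
exists (Witt s); apply: LambdaP => -[|n] //.
rewrite lser_exp // [wcomp _ _]sE /G mulr_signK.
by rewrite opprB subrKC.
Qed.

Lemma witt_expK f : witt_exp (witt_exp_inv f) = f.
Proof. exact: xgetPex (witt_exp_surj f). Qed.

Lemma witt_exp_bij : bijective (@witt_exp A).
Proof.
exists (@witt_exp_inv A) => [a|f]; last exact: witt_expK.
by apply: witt_exp_inj; rewrite witt_expK.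
Qed.

Section Ideal.
Variable J : set A.
Hypothesis idJ : is_ideal J.

Lemma is_ideal_sum (I : Type) (r : seq I) (P : pred I) (F : I -> A) :
  (forall i, P i -> J (F i)) -> J (\sum_(i <- r | P i) F i).
Proof. by move=> H; apply: big_ind => //; [apply: ideal0 | apply: idealD]. Qed.

Lemma is_idealMr (y x : A) : J x -> J (x * y).
Proof. by rewrite mulrC; apply: idealM. Qed.

Lemma is_idealN (x : A) : J x -> J (- x).
Proof. by move=> Jx; rewrite -mulN1r; apply: idealM. Qed.

Lemma is_idealB (x y : A) : J x -> J y -> J (x - y).
Proof. by move=> Jx Jy; apply: idealD => //; apply: is_idealN. Qed.

(** Series whose coefficients of positive degree lie in J are closed under products. *)
Lemma exp_trunc_ideal a m n : (forall i, (i.+1 < m)%N -> J (wcoef a i)) ->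
  J (coefs (exp_trunc a m) n.+1).
Proof.
move=> Ja; move: n; rewrite /exp_trunc big_nat_cond.
apply: (big_ind (fun u : series A => forall n, J (coefs u n.+1))).
- by move=> n; apply: ideal0.
- move=> u v Ju Jv n; rewrite coefsM; apply: is_ideal_sum => -[[|i] lt] _ /=.
    by apply: idealM => //; rewrite subn0.
  exact: is_idealMr.
case=> // i /andP[/andP[_ lt] _] n; rewrite -[exp_fac _ _]mul1r coefs_exp_fac.
apply: is_idealB => //; first exact: ideal0.
by case: ifP => _; [rewrite -mulrA; apply/is_idealMr/Ja | apply: ideal0].
Qed.

(** Triangularity gives the converse by strong induction. This equivalence translates closure of a
    filtration ideal under the lambda-operations into compatibility of the coaction with the
    filtration. *)
Lemma witt_exp_ideal a :
  (forall i, J (wcoef a i)) <-> (forall k, J (lambda_coef (witt_exp a) k)).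
Proof.
split=> [Ja k|Jf i].
  rewrite -[lambda_coef _ _]/(lser (witt_exp a) k.+1) lser_exp_trunc0.
  by apply: exp_trunc_ideal => i _; apply: Ja.
have [m] := ubnP i; elim: m i => // m IH i; rewrite ltnS => im.
have : J (coefs (exp_trunc a i.+1) i.+1 - lser (witt_exp a) i.+1).
  apply: is_idealB; last exact: (Jf i); apply: exp_trunc_ideal => j; rewrite ltnS => ji.
  by apply: IH; apply: leq_trans im.
rewrite lser_exp // opprB subrKC => /(is_idealMr ((- 1) ^+ i.+1)).
by rewrite mulr_signK.
Qed.

End Ideal.
End Exponential.

Lemma lser_exp_map (A B : comPzRingType) (f : {rmorphism A -> B}) a n :
  lser (witt_exp (witt_map f a)) n = f (lser (witt_exp a) n).
Proof.
rewrite !lser_exp_trunc0 -[RHS]/(coefs (smap f (exp_trunc a n.+1)) n).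
congr coefs; rewrite /exp_trunc (big_morph _ (smapM f) (smap1 f)).
apply: eq_bigr => i _; apply: seriesP => k.
rewrite -[LHS]/((k == 0%N)%:R - (f (wcomp a i) * (- 1) ^+ i) *+ (k == i)).
rewrite -[RHS]/(f ((k == 0%N)%:R - (wcomp a i * (- 1) ^+ i) *+ (k == i))).
by rewrite rmorphB rmorph_nat rmorphMn rmorphM rmorphXn rmorphN1.
Qed.

(** * Newton's identities *)

Section Newton.
Variable A : comPzRingType.
Implicit Types (a b : witt A).

(* For f = E(a) one has t f' = newton a * f.  The term of index 0 is set apart because
   [ghost 0] takes the junk value [wcomp a 1 ^+ 0]. *)
Definition newton a : series A := Series (fun k =>
  if k is 0%N then 0 else - (ghost k a * (- 1) ^+ k)).

(** The logarithmic derivative t g'/g of g = 1 - c t^i, where c = (-1)^i a_i: it is - i times the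
    sum of the c^q t^(iq) over q >= 1. *)
Definition newton_fac a i : series A := Series (fun k =>
  if (0 < k)%N && (i %| k)%N then - ((wcomp a i * (- 1) ^+ i) ^+ (k %/ i) *+ i) else 0).

Lemma euler_exp_fac a i : (0 < i)%N ->
  seuler (exp_fac a i) = newton_fac a i * exp_fac a i.
Proof.
move=> i0; apply: seriesP => k; rewrite coefs_exp_fac.
set c := _ * _ ^+ _.
have -> : coefs (seuler (exp_fac a i)) k = - (c *+ i *+ (k == i)).
  rewrite -[LHS]/(((k == 0%N)%:R - c *+ (k == i)) *+ k) mulrnBl -!mulrnA.
  case: (k =P i) => [->|_]; last first.
    by rewrite muln0 mul0n; case: k => [|k]; rewrite ?muln0 ?mul0n subrr oppr0.
  by rewrite mul1n muln1 eqn0Ngt i0 mul0n sub0r.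
rewrite /newton_fac /= -/c; case: (leqP i k) => [le|lt]; last first.
  rewrite ltn_eqF // mulr0n oppr0 addr0; case: k lt => // k lt.
  by rewrite gtnNdvd.
have dvE : (i %| k - i)%N = (i %| k)%N by rewrite -{2}(subnK le) dvdn_addl.
rewrite (leq_trans i0 le) /= subn_gt0 dvE.
case: (ltngtP i k) le => // [lt|<-] _; last first.
  by rewrite dvdnn divnn i0 expr1 mulr1n mulr0 subr0.
rewrite /= mulr0n oppr0; case: ifP => [dv|_]; last by rewrite mulr0 subr0.
rewrite mulrN mulrnAr -exprS opprK divnBr ?dvdnn // divnn i0 subn1 prednK ?addNr //.
by rewrite divn_gt0 // ltnW.
Qed.

Lemma euler_exp_trunc a m :
  seuler (exp_trunc a m) = (\sum_(1 <= i < m) newton_fac a i) * exp_trunc a m.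
Proof.
have e1 : seuler (1 : series A) = 0.
  by apply: seriesP => -[|k]; rewrite //= /ser_one mul0rn.
elim: m => [|[|m] IH]; try by rewrite /exp_trunc !big_geq // mul0r e1.
rewrite exp_truncS // seulerM IH euler_exp_fac // [in RHS]big_nat_recr //=.
by rewrite mulrDl -mulrA; congr (_ + _); rewrite mulrCA.
Qed.

(** Only the divisors i of k contribute, each with the sign (-1)^(i (k/i)) = (-1)^k, which leaves
    the ghost component w_k. *)
Lemma coefs_newton a k m : (k < m)%N ->
  coefs (\sum_(1 <= i < m) newton_fac a i) k = coefs (newton a) k.
Proof.
rewrite coefs_sum /newton; case: k => [|k] lt /=.
  by rewrite big1.
case: m lt => // m; rewrite ltnS => lt.
rewrite (@ghostE _ _ _ m) ?lt // mulr_suml -sumrN big_mkcond [RHS]big_mkcond /=.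
apply: eq_bigr => i _; case: ifP => // dv.
by rewrite exprMn -exprM mulnC divnK // mulrnAl.
Qed.

Lemma newton_exp a : seuler (lsr (witt_exp a)) = newton a * lsr (witt_exp a).
Proof.
apply: seriesP => n; rewrite -[LHS]/(lser (witt_exp a) n *+ n).
rewrite (@lser_exp_trunc _ _ _ n.+1) // -[LHS]/(coefs (seuler (exp_trunc a n.+1)) n).
rewrite euler_exp_trunc !coefsM; apply: eq_bigr => i _.
rewrite coefs_newton // -(@lser_exp_trunc _ _ _ n.+1) //.
by rewrite ltnS leq_subr.
Qed.

End Newton.

Section TorsionFree.
Variable A : comPzRingType.
Hypothesis tf : forall n (x : A), (0 < n)%N -> x *+ n = 0 -> x = 0.

Lemma mulrnI_tf n : (0 < n)%N -> injective (fun x : A => x *+ n).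
Proof.
by move=> n0 x y /eqP; rewrite -subr_eq0 -mulrnBl => /eqP/(tf n0)/eqP; rewrite subr_eq0 => /eqP.
Qed.

(** As w_0 = 0, the equation t u' = w u expresses n u_n through w_1, ..., w_n and the earlier
    coefficients of u, and n can be cancelled. *)
Lemma eq_euler (u v w w' : series A) n :
  seuler u = w * u -> seuler v = w' * v -> coefs u 0 = coefs v 0 ->
  coefs w 0 = 0 -> coefs w' 0 = 0 ->
  (forall i, (0 < i <= n)%N -> coefs w i = coefs w' i) -> coefs u n = coefs v n.
Proof.
move=> eu ev uv0 w0 w'0; have [m] := ubnP n; elim: m n => // m IH [|n] //.
rewrite ltnS => nm ww; apply: (@mulrnI_tf n.+1) => //.
rewrite -[LHS]/(coefs (seuler u) n.+1) -[RHS]/(coefs (seuler v) n.+1) eu ev.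
rewrite !coefsM big_ord_recl [in RHS]big_ord_recl w0 w'0 !mul0r; congr (_ + _).
apply: eq_bigr => i _; rewrite ww /=; last exact: ltn_ord.
congr (_ * _); apply: IH; first by rewrite subSS (leq_trans _ nm) // ltnS leq_subr.
by move=> j /andP[j0 jn]; apply: ww; rewrite j0 (leq_trans jn) ?leq_subr.
Qed.

Lemma eq_lser_ghost (a b : witt A) n :
  (forall i, (0 < i <= n)%N -> ghost i a = ghost i b) ->
  lser (witt_exp a) n = lser (witt_exp b) n.
Proof.
move=> e; apply: (eq_euler (newton_exp a) (newton_exp b)) => //.
by case=> // i /e; rewrite /= => ->.
Qed.

Lemma tf_lsr_expD (a b : witt A) :
  lsr (witt_exp (a + b)) = lsr (witt_exp a) * lsr (witt_exp b).
Proof.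
apply: seriesP => n; apply: (eq_euler (newton_exp _)).
- by rewrite seulerM !newton_exp mulrCA -mulrA -mulrDl.
- by rewrite coefsM big_ord_recl big_ord0 /= mulr1 addr0.
- by [].
- by rewrite coefsD addr0.
by case=> // i _; rewrite /= [ghost _ _]ghost_wadd // mulrDl opprD.
Qed.

End TorsionFree.

(** * Teichmueller vectors and Frobenius operators *)

HB.instance Definition _ (A B : comPzRingType) (f : {rmorphism A -> B}) :=
  GRing.isZmodMorphism.Build (witt A) (witt B) (witt_map f) (witt_map_rmorph f).1.
HB.instance Definition _ (A B : comPzRingType) (f : {rmorphism A -> B}) :=
  GRing.isMonoidMorphism.Build (witt A) (witt B) (witt_map f) (witt_map_rmorph f).2.

(** The index is a successor because [ghost 0] is the constant 1, which is not additive in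
    general. *)
HB.instance Definition _ (A : comPzRingType) n :=
  GRing.isZmodMorphism.Build (witt A) A (@ghost A n.+1) (@ghost_rmorph A n.+1 isT).1.
HB.instance Definition _ (A : comPzRingType) n :=
  GRing.isMonoidMorphism.Build (witt A) A (@ghost A n.+1) (@ghost_rmorph A n.+1 isT).2.

Definition torsion_free (A : comPzRingType) : Prop :=
  forall n (x : A), (0 < n)%N -> x *+ n = 0 -> x = 0.

(* Functorial identities in W(A) need only be checked in W(F), where the ghost
   components are jointly injective.  The existential hides the polynomial ring F, on
   which conversion explodes. *)
Lemma torsion_free_cover (A : comPzRingType) :
  exists (F : comPzRingType) (ev : {rmorphism F -> A}) (lift : A -> F),
    cancel lift ev /\ torsion_free F.
Proof.
exists (ipoly A), (ipoly_eval (fun x : A => x)), (@ivar A).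
by split; [move=> x; apply: ipoly_eval_var | apply: ipoly_tf].
Qed.

Section Exponential.
Variable A : comPzRingType.

Lemma lsr_expD (a b : witt A) :
  lsr (witt_exp (a + b)) = lsr (witt_exp a) * lsr (witt_exp b).
Proof.
have [F [ev [lift [liftK tf]]]] := torsion_free_cover A.
(* [lift] is a mere map of sets, applied to each component; the identity comes back to A along the
   ring morphism [ev]. *)
have wK (c : witt A) : witt_map ev (witt_map lift c) = c.
  by apply: wittP => i; apply: liftK.
have E c : lsr (witt_exp (witt_map ev c)) = smap ev (lsr (witt_exp c)).
  by apply: seriesP => n; rewrite /= lser_exp_map.
have := congr1 (smap ev) (tf_lsr_expD tf (witt_map lift a) (witt_map lift b)).
by rewrite smapM -!E rmorphD /= !wK.
Qed.

Lemma lsr_exp0 : lsr (witt_exp (0 : witt A)) = 1.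
Proof.
apply: seriesP => n; rewrite [coefs _ _]lser_exp_trunc0 /exp_trunc.
rewrite big1 // => i _; rewrite /exp_fac [wcomp _ _]/= mul0r.
by apply: seriesP => k; rewrite /= mul0rn subr0.
Qed.

Lemma lsr_exp_sum (I : Type) (r : seq I) (P : pred I) (F : I -> witt A) :
  lsr (witt_exp (\sum_(i <- r | P i) F i)) = \prod_(i <- r | P i) lsr (witt_exp (F i)).
Proof. exact: (big_morph _ lsr_expD lsr_exp0). Qed.

Definition teich (x : A) : witt A := Witt (fun i => if i == 0%N then x else 0).

Lemma lsr_exp_teich x : lsr (witt_exp (teich x)) = 1 + smon 1 x.
Proof.
(* Truncating at n + 2 keeps the factor of index 1 even when n = 0. *)
apply: seriesP => n; rewrite [coefs _ _](@lser_exp_trunc _ _ _ n.+2) // /exp_trunc.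
rewrite big_ltn // big_nat_cond big1 => [|[|[|i]] //]; last first.
  move=> _; rewrite /exp_fac [wcomp _ _]/= mul0r.
  by apply: seriesP => k; rewrite /= mul0rn subr0.
rewrite mulr1 /exp_fac [wcomp _ _]/= expr1 mulrN1.
by rewrite [RHS]coefsD /= mulNrn opprK.
Qed.

Lemma ghost_teich n x : (0 < n)%N -> ghost n (teich x) = x ^+ n.
Proof.
move=> n0; rewrite (@ghostE _ _ _ n) ?n0 ?leqnn // big_mkcond big_ltn // dvd1n divn1.
rewrite big_nat_cond big1 /=; first by rewrite addr0.
case=> [|[|i]] //= _.
case: ifP => // /(dvdn_leq n0) le'; rewrite expr0n eqn0Ngt.
by rewrite divn_gt0 // le' mul0rn.
Qed.

Lemma teich1 : teich 1 = 1.
Proof. by apply: wittP => -[|i]. Qed.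

End Exponential.

Lemma witt_map_teich (A B : comPzRingType) (f : {rmorphism A -> B}) x :
  witt_map f (teich x) = teich (f x).
Proof. by apply: wittP => i /=; case: eqP; rewrite ?rmorph0. Qed.

Lemma teichM (A : comPzRingType) : {morph @teich A : x y / x * y}.
Proof.
have [F [ev [lift [liftK tf]]]] := torsion_free_cover A => x y.
have : teich (lift x * lift y) = teich (lift x) * teich (lift y).
  apply: (ghost_inj tf) => n n0.
  by rewrite [RHS]ghost_wmul // !ghost_teich // exprMn.
move/(congr1 (witt_map ev)).
by rewrite rmorphM /= !witt_map_teich rmorphM /= !liftK.
Qed.

(** By Bezout km m = kn n + 1, so x = km m x - kn n x. Both terms are multiples of m n, because x is
    a multiple of n and of m. *)
Lemma nat_dvd_coprime (A : comPzRingType) m n (x : A) : coprime m n -> (0 < m)%N ->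
  nat_dvd m x -> nat_dvd n x -> nat_dvd (m * n) x.
Proof.
move=> cop m0 [y xy] [z xz]; case: (egcdnP n m0) => km kn e _.
rewrite (eqP cop) addn1 in e; exists (z *+ km - y *+ kn).
have e1 : z *+ km *+ (m * n) = x *+ (km * m).
  by rewrite xz -!mulrnA; congr (_ *+ _); rewrite mulnA mulnC.
have e2 : y *+ kn *+ (m * n) = x *+ (kn * n).
  by rewrite xy -!mulrnA; congr (_ *+ _); rewrite mulnCA.
by rewrite mulrnBl e1 e2 e mulrS addrK.
Qed.

(** Induction on n, splitting off the part at its smallest prime factor. This makes [dwork]
    applicable over rings such as W(U), where divisibility cannot be read off coefficients. *)
Lemma nat_dvd_part (A : comPzRingType) n (x : A) : (0 < n)%N ->
  (forall p, prime p -> (p %| n)%N -> nat_dvd (p ^ logn p n) x) -> nat_dvd n x.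
Proof.
have [m] := ubnP n; elim: m n => // m IH n; rewrite ltnS => nm n0 H.
have [n1|n1] := leqP n 1.
  by exists x; rewrite (_ : n = 1%N) //; apply/eqP; rewrite eqn_leq n1.
have pp := pdiv_prime n1; set p := pdiv n in pp.
have [k cop nE] := pfactor_coprime pp n0.
have k0 : (0 < k)%N by move: n0; rewrite nE muln_gt0 => /andP[].
have pdn : (p %| n)%N := pdiv_dvd n.
have kn : (k %| n)%N by rewrite nE dvdn_mulr.
rewrite nE; apply: nat_dvd_coprime => //; first by rewrite coprime_sym coprimeXl.
- apply: IH => //.
    rewrite (leq_trans _ nm) // nE ltn_Pmulr // -(expn0 p) ltn_exp2l ?prime_gt1 //.
    by rewrite logn_gt0 mem_primes pp n0.
  move=> q pq qk; apply: nat_dvd_trans (H q pq (dvdn_trans qk kn)).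
  by apply: dvdn_exp2l; apply: dvdn_leq_log.
exact: H.
Qed.

Definition gen_witt : witt (ipoly nat) := Witt (@ivar nat).

Definition frob_poly m : witt (ipoly nat) :=
  xget gen_witt (fun s => forall n, (0 < n)%N -> ghost n s = ghost (n * m.+1) gen_witt).

(** The Dwork congruence of a at n (m + 1) holds modulo a power of p at least as high as the one
    required at n. *)
Lemma ghost_cong_mul (U : comPzRingType) (frob : nat -> {rmorphism U -> U}) m a :
  (forall p x, prime p -> nat_dvd p (frob p x - x ^+ p)) ->
  ghost_cong frob (fun n => ghost (n * m.+1) a).
Proof.
move=> frobP p n pp pn n0; have pnm : (p %| n * m.+1)%N by rewrite dvdn_mulr.
have := ghost_congP frobP a pp pnm; rewrite muln_gt0 n0 => /(_ isT).
rewrite -divn_mulAC //; apply: nat_dvd_trans; apply: dvdn_exp2l.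
by rewrite lognM // leq_addr.
Qed.

Lemma ghost_frob_poly m n : (0 < n)%N -> ghost n (frob_poly m) = ghost (n * m.+1) gen_witt.
Proof.
have gC := @ghost_cong_mul _ (@ipoly_frob nat) m gen_witt (@ipoly_frobP nat).
exact: (xgetPex gen_witt (dwork (@ipoly_frobP _) (@ipoly_dvd_part _) gC)).
Qed.

(* Indices are shifted: [wfrob m] is the Frobenius operator F_(m+1). *)
HB.lock Definition wfrob (A : comPzRingType) m (a : witt A) : witt A :=
  witt_map (ipoly_eval (wcoef a)) (frob_poly m).

Lemma witt_map_eval_var (A : comPzRingType) (a : witt A) :
  witt_map (ipoly_eval (wcoef a)) gen_witt = a.
Proof. by apply: wittP => i; apply: ipoly_eval_var. Qed.

Lemma ghost_wfrob (A : comPzRingType) m n (a : witt A) : (0 < n)%N ->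
  ghost n (wfrob m a) = ghost (n * m.+1) a.
Proof.
move=> n0; rewrite wfrob.unlock ghost_wmap ghost_frob_poly // -ghost_wmap.
by rewrite witt_map_eval_var.
Qed.

Lemma witt_map_frob (A B : comPzRingType) (f : {rmorphism A -> B}) m a :
  witt_map f (wfrob m a) = wfrob m (witt_map f a).
Proof. by rewrite wfrob.unlock; apply: wittP => i; rewrite /= ipoly_eval_comp. Qed.

Lemma wmap_liftK (A B : Type) (f : A -> B) (g : B -> A) :
  cancel g f -> cancel (witt_map g) (witt_map f).
Proof. by move=> gK a; apply: wittP => i; apply: gK. Qed.

Section FrobeniusMorphism.
Variables (A : comPzRingType) (m : nat).

Lemma wfrob_zmod : zmod_morphism (@wfrob A m).
Proof.
have [F [ev [lift [/wmap_liftK wK tf]]]] := torsion_free_cover A => a b.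
have : wfrob m (witt_map lift a - witt_map lift b) =
       wfrob m (witt_map lift a) - wfrob m (witt_map lift b).
  apply: (ghost_inj tf) => -[//|n] _.
  by rewrite rmorphB /= !ghost_wfrob // mulnS addSn rmorphB.
by move/(congr1 (witt_map ev)); rewrite rmorphB /= !witt_map_frob rmorphB /= !wK.
Qed.

Lemma wfrob_monoid : monoid_morphism (@wfrob A m).
Proof.
have [F [ev [lift [/wmap_liftK wK tf]]]] := torsion_free_cover A; split=> [|a b].
  have : wfrob m (1 : witt F) = 1.
    apply: (ghost_inj tf) => -[//|n] _.
    by rewrite ghost_wfrob // mulnS addSn !rmorph1.
  by move/(congr1 (witt_map ev)); rewrite witt_map_frob rmorph1.
have : wfrob m (witt_map lift a * witt_map lift b) =
       wfrob m (witt_map lift a) * wfrob m (witt_map lift b).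
  apply: (ghost_inj tf) => -[//|n] _.
  by rewrite rmorphM /= !ghost_wfrob // mulnS addSn rmorphM.
by move/(congr1 (witt_map ev)); rewrite rmorphM /= !witt_map_frob rmorphM /= !wK.
Qed.

End FrobeniusMorphism.

HB.instance Definition _ (A : comPzRingType) m :=
  GRing.isZmodMorphism.Build (witt A) (witt A) (@wfrob A m) (@wfrob_zmod A m).
HB.instance Definition _ (A : comPzRingType) m :=
  GRing.isMonoidMorphism.Build (witt A) (witt A) (@wfrob A m) (@wfrob_monoid A m).

(** * The comultiplication *)

Lemma witt_tf (A : comPzRingType) : torsion_free A -> torsion_free (witt A).
Proof.
move=> tf n x n0 x0; apply: (ghost_inj tf) => -[//|k] _.
apply: (mulrnI_tf tf n0); by rewrite -rmorphMn x0 !rmorph0 mul0rn.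
Qed.

Lemma ghost_ghost_inj (A : comPzRingType) (b c : witt (witt A)) : torsion_free A ->
  (forall m n, (0 < m)%N -> (0 < n)%N -> ghost n (ghost m b) = ghost n (ghost m c)) ->
  b = c.
Proof.
move=> tf e; apply: (ghost_inj (witt_tf tf)) => m m0.
by apply: (ghost_inj tf) => n n0; apply: e.
Qed.

Section FrobeniusLiftWitt.
Variables (U : comPzRingType) (frob : nat -> {rmorphism U -> U}).
Hypothesis tf : torsion_free U.
Hypothesis frobP : forall p x, prime p -> nat_dvd p (frob p x - x ^+ p).

Lemma coprime_tf_dvd m n (x : U) : coprime m n -> (0 < m)%N -> nat_dvd m (x *+ n) ->
  nat_dvd m x.
Proof.
move=> cop m0 [y xy]; case: (egcdnP n m0) => km kn e _.
rewrite (eqP cop) addn1 in e; exists (x *+ km - y *+ kn).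
rewrite mulrnBl -!mulrnA e [(kn * m)%N]mulnC [y *+ _]mulrnA -xy.
by rewrite -mulrnA [(n * kn)%N]mulnC mulrS addrK.
Qed.

(** The ghost components h of F_p(a) - a^p are divisible by p, and the quotients k again satisfy
    Dwork's congruences. They are thus the ghost components of some y with F_p(a) - a^p = p y. *)
Lemma wfrobP p (a : witt U) : prime p -> nat_dvd p (wfrob p.-1 a - a ^+ p).
Proof.
move=> pp; have p0 := prime_gt0 pp.
pose h n := ghost (n * p) a - ghost n a ^+ p.
have hE n : (0 < n)%N -> ghost n (wfrob p.-1 a - a ^+ p) = h n.
  by case: n => // n _; rewrite rmorphB rmorphXn /= ghost_wfrob // prednK.
have gC := ghost_congP frobP a.
have hdiv n : (0 < n)%N -> nat_dvd p (h n).
  move=> n0; have np0 : (0 < n * p)%N by rewrite muln_gt0 n0.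
  have := gC p (n * p)%N pp (dvdn_mull _ (dvdnn p)) np0; rewrite mulnK // => H.
  rewrite /h -(subrKA (frob p (ghost n a))); apply: nat_dvdD; last exact: frobP.
  apply: nat_dvd_trans H; rewrite -{1}(expn1 p) dvdn_exp2l // logn_gt0.
  by rewrite mem_primes pp np0 dvdn_mull.
(* For q = p the modulus is one power higher than Dwork's congruence requires, which makes up for
   the division of h by p in [kC]. *)
have hcong q n : prime q -> (q %| n)%N -> (0 < n)%N ->
    nat_dvd (q ^ logn q (n * p)) (h n - frob q (h (n %/ q)%N)).
  move=> pq qn n0; have q0 := prime_gt0 pq; have np0 : (0 < n * p)%N by rewrite muln_gt0 n0.
  rewrite /h rmorphB rmorphXn opprB [X in _ + X]addrC addrACA.
  apply: nat_dvdD.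
    by have := gC q (n * p)%N pq (dvdn_mulr _ qn) np0; rewrite -divn_mulAC.
  rewrite addrC -opprB; apply: nat_dvdN; have := gC q n pq qn n0.
  have [<-|npq] := eqVneq q p; last first.
    rewrite lognM // (logn_prime _ pp) (negbTE npq) addn0.
    exact: nat_dvdBX.
  (* Here q = p: taking p-th powers raises the modulus from p^l to p^(l+1) as soon as l > 0. *)
  have : (0 < logn q n)%N by rewrite logn_gt0 mem_primes pq n0.
  rewrite lognM // (logn_prime _ pq) eqxx addn1.
  by case: (logn q n) => // l _ /nat_dvdBXp.
have /choice[k kE] : forall n, exists y, (0 < n)%N -> h n = y *+ p.
  move=> n; case: (posnP n) => [_|n0]; first by exists 0.
  by have [y e] := hdiv n n0; exists y.
have kC : ghost_cong frob k.
  move=> q n pq qn n0; have q0 := prime_gt0 pq.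
  have nq0 : (0 < n %/ q)%N by rewrite divn_gt0 ?prime_gt0 // dvdn_leq.
  have := hcong q n pq qn n0; rewrite !kE // rmorphMn /= -mulrnBl.
  have [<-|npq] := eqVneq q p; last first.
    rewrite lognM // (logn_prime _ pp) (negbTE npq) addn0.
    apply: coprime_tf_dvd; last by rewrite expn_gt0 prime_gt0.
    by rewrite coprimeXl // prime_coprime // dvdn_prime2.
  rewrite lognM // (logn_prime _ pq) eqxx addn1 => -[u].
  rewrite expnSr mulrnA => /(mulrnI_tf tf (prime_gt0 pq)) ->.
  by exists u.
have [y yE] := dwork frobP (@nat_dvd_part U) kC.
exists y; apply: (ghost_inj tf) => n n0.
by rewrite hE // kE // -yE //; case: n n0 => // n _; rewrite rmorphMn.
Qed.

(* Dwork's lemma over the torsion-free ring W(U), whose Frobenius lifts are the F_p: the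
   congruences are equalities, since F_n = F_p F_(n/p). *)
Lemma comult_exists (a : witt U) :
  exists b : witt (witt U), forall m, (0 < m)%N -> ghost m b = wfrob m.-1 a.
Proof.
pose frobW (p : nat) : {rmorphism witt U -> witt U} := @wfrob U p.-1.
have gC : ghost_cong frobW (fun m => wfrob m.-1 a).
  move=> p n pp pn n0; suff e : wfrob p.-1 (wfrob (n %/ p).-1 a) = wfrob n.-1 a.
    by rewrite -e subrr; apply: nat_dvd0.
  have np0 : (0 < n %/ p)%N by rewrite divn_gt0 ?prime_gt0 // dvdn_leq.
  apply: (ghost_inj tf) => k k0.
  have kp0 : (0 < k * p.-1.+1)%N by rewrite muln_gt0 k0.
  rewrite (ghost_wfrob _ _ k0) (ghost_wfrob _ _ kp0) (ghost_wfrob _ _ k0).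
  by rewrite -mulnA !prednK ?(prime_gt0 pp) // [(p * _)%N]mulnC divnK.
have FP : forall q x, prime q -> nat_dvd q (frobW q x - x ^+ q).
  by move=> q x; apply: wfrobP.
by have := dwork FP (@nat_dvd_part (witt U)) gC.
Qed.

End FrobeniusLiftWitt.

Definition comult_poly : witt (witt (ipoly nat)) :=
  xget (Witt (fun=> gen_witt)) (fun s => forall m, (0 < m)%N -> ghost m s = wfrob m.-1 gen_witt).

Lemma ghost_comult_poly m : (0 < m)%N -> ghost m comult_poly = wfrob m.-1 gen_witt.
Proof. exact: (xgetPex _ (comult_exists (@ipoly_tf nat) (@ipoly_frobP nat) gen_witt)). Qed.

(** The comultiplication given by universal polynomials, for which naturality and ghost components
    are at hand. It is identified with [witt_comult] in [witt_comultE]. *)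
HB.lock Definition wcomult (A : comPzRingType) (a : witt A) : witt (witt A) :=
  witt_map (witt_map (ipoly_eval (wcoef a))) comult_poly.

Lemma ghost_wcomult (A : comPzRingType) m (a : witt A) : (0 < m)%N ->
  ghost m (wcomult a) = wfrob m.-1 a.
Proof.
move=> m0; rewrite wcomult.unlock ghost_wmap ghost_comult_poly //.
by rewrite [LHS](witt_map_frob (ipoly_eval (wcoef a))) witt_map_eval_var.
Qed.

Lemma wcomult_map (A B : comPzRingType) (f : {rmorphism A -> B}) a :
  witt_map (witt_map f) (wcomult a) = wcomult (witt_map f a).
Proof.
rewrite wcomult.unlock; apply: wittP => i; apply: wittP => j; rewrite /= ipoly_eval_comp.
by [].
Qed.

Lemma ghost_ghost_wcomult (A : comPzRingType) m n (a : witt A) :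
  (0 < m)%N -> (0 < n)%N -> ghost n (ghost m (wcomult a)) = ghost (n * m) a.
Proof. by move=> m0 n0; rewrite ghost_wcomult // ghost_wfrob // prednK. Qed.

Section WittComonad.
Variable A : comPzRingType.

Lemma wcomult_zmod : zmod_morphism (@wcomult A).
Proof.
have [F [ev [lift [/wmap_liftK wK tf]]]] := torsion_free_cover A => a b.
have : wcomult (witt_map lift a - witt_map lift b) =
       wcomult (witt_map lift a) - wcomult (witt_map lift b).
  apply: (ghost_inj (witt_tf tf)) => -[//|m] _.
  by rewrite rmorphB /= !ghost_wcomult // rmorphB.
move/(congr1 (witt_map (witt_map ev))).
by rewrite rmorphB /= !wcomult_map rmorphB /= !wK.
Qed.

Lemma wcomult_monoid : monoid_morphism (@wcomult A).
Proof.
have [F [ev [lift [/wmap_liftK wK tf]]]] := torsion_free_cover A; split=> [|a b].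
  have : wcomult (1 : witt F) = 1.
    apply: (ghost_inj (witt_tf tf)) => -[//|m] _.
    by rewrite ghost_wcomult // !rmorph1.
  by move/(congr1 (witt_map (witt_map ev))); rewrite wcomult_map !rmorph1.
have : wcomult (witt_map lift a * witt_map lift b) =
       wcomult (witt_map lift a) * wcomult (witt_map lift b).
  apply: (ghost_inj (witt_tf tf)) => -[//|m] _.
  by rewrite rmorphM /= !ghost_wcomult // rmorphM.
move/(congr1 (witt_map (witt_map ev))).
by rewrite rmorphM /= !wcomult_map rmorphM /= !wK.
Qed.

End WittComonad.

HB.instance Definition _ (A : comPzRingType) := GRing.isZmodMorphism.Build
  (witt A) (witt (witt A)) (@wcomult A) (@wcomult_zmod A).
HB.instance Definition _ (A : comPzRingType) := GRing.isMonoidMorphism.Build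
  (witt A) (witt (witt A)) (@wcomult A) (@wcomult_monoid A).

Section WittComonadLaws.
Variable A : comPzRingType.

Lemma ghost1 (a : witt A) : ghost 1%N a = wcoef a 0.
Proof. by rewrite /ghost (_ : divisors 1 = [:: 1%N]) // big_seq1 expr1. Qed.

Lemma wcomult_counitl (a : witt A) : witt_map (@ghost A 1) (wcomult a) = a.
Proof.
have [F [ev [lift [/wmap_liftK wK tf]]]] := torsion_free_cover A.
have : witt_map (@ghost F 1) (wcomult (witt_map lift a)) = witt_map lift a.
  apply: (ghost_inj tf) => n n0.
  by rewrite ghost_wmap [LHS]ghost_ghost_wcomult // mul1n.
move/(congr1 (witt_map ev)).
rewrite wK => {2}<-; rewrite -{1}(wK a) -wcomult_map; apply: wittP => i /=.
by rewrite ghost_wmap.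
Qed.

Lemma wcomult_counitr (a : witt A) : ghost 1%N (wcomult a) = a.
Proof.
have [F [ev [lift [/wmap_liftK wK tf]]]] := torsion_free_cover A.
have : ghost 1%N (wcomult (witt_map lift a)) = witt_map lift a.
  by apply: (ghost_inj tf) => n n0; rewrite ghost_ghost_wcomult // muln1.
by move/(congr1 (witt_map ev)); rewrite -ghost_wmap wcomult_map wK.
Qed.

Lemma wcomultA (a : witt A) :
  witt_map (@wcomult A) (wcomult a) = wcomult (wcomult a).
Proof.
have [F [ev [lift [/wmap_liftK wK tf]]]] := torsion_free_cover A.
have : witt_map (@wcomult F) (wcomult (witt_map lift a)) =
    wcomult (wcomult (witt_map lift a)).
  (* On both sides w_k w_n w_m equals w_(knm) of the lifted vector. *)
  apply: (ghost_inj (witt_tf (witt_tf tf))) => m m0.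
  apply: (ghost_ghost_inj tf) => n k n0 k0.
  rewrite ghost_wmap ghost_ghost_wcomult // ghost_wcomult // ghost_wfrob ?muln_gt0 ?k0 //.
  rewrite ghost_ghost_wcomult // ghost_ghost_wcomult ?muln_gt0 ?n0 // prednK //.
  by rewrite mulnA.
move/(congr1 (witt_map (witt_map (witt_map ev)))).
rewrite wcomult_map wcomult_map wK => <-.
rewrite -{1}(wK a) -wcomult_map; apply: wittP => i.
exact/esym/wcomult_map.
Qed.

Lemma wcomult_teich (x : A) : wcomult (teich x) = teich (teich x).
Proof.
have [F [ev [lift [liftK tf]]]] := torsion_free_cover A.
have : wcomult (teich (lift x)) = teich (teich (lift x)).
  apply: (ghost_ghost_inj tf) => m [//|n] m0 _.
  by rewrite ghost_ghost_wcomult // !ghost_teich ?muln_gt0 // rmorphXn /= ghost_teich // exprM.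
move/(congr1 (witt_map (witt_map ev))).
by rewrite wcomult_map !witt_map_teich /= witt_map_teich liftK.
Qed.

End WittComonadLaws.

(** * Substitution of elementary symmetric functions *)

Section Zeval.
Import mpoly.
Variables (n : nat) (A : comPzRingType).

Lemma zeval_rmorph (v : 'I_n -> A) :
  zmod_morphism (fun p => zeval p v) /\ monoid_morphism (fun p => zeval p v).
Proof.
(* In the zero ring all elements agree; otherwise A is a nonzero ring B, over which [zeval] is
   [mmap]. *)
have [A0|A1] := eqVneq (1 : A) 0.
  have all0 (x y : A) : x = y by rewrite -[x]mul1r -[y]mul1r A0 !mul0r.
  by split=> [x y|]; [apply: all0 | split=> [|x y]; apply: all0].
pose isn := GRing.PzSemiRing_isNonZero.Build A A1.
pose B : comNzRingType := HB.pack A isn.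
pose w : 'I_n -> B := v; pose e : {rmorphism int -> B} := intr.
have E p : zeval p v = mmap e w p.
  by apply: eq_bigr => m _; rewrite -mulrzl.
split=> [x y|]; first by rewrite !E; apply: (mmap_is_additive w e).
have [hM h1] := mmap_is_multiplicative w e.
by split=> [|x y]; rewrite !E; [apply: h1 | apply: hM].
Qed.

Definition zeval_at v : {rmorphism {mpoly int[n]} -> A} :=
  HB.pack (fun p => @zeval n A p v)
    (GRing.isZmodMorphism.Build {mpoly int[n]} A _ (zeval_rmorph v).1)
    (GRing.isMonoidMorphism.Build {mpoly int[n]} A _ (zeval_rmorph v).2).

Lemma zeval_var v i : zeval_at v 'X_i = v i.
Proof.
rewrite /= /zeval msuppX big_seq1 mcoeffX eqxx mulr1z.
rewrite (bigD1 i) //= mnm1E eqxx expr1 big1 ?mulr1 // => j /negbTE ne.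
by rewrite mnm1E eq_sym ne.
Qed.

Lemma mpoly_rmorphE (f : {rmorphism {mpoly int[n]} -> A}) p :
  f p = zeval_at (fun i => f 'X_i) p.
Proof.
rewrite {1}[p]mpolyE rmorph_sum; apply: eq_bigr => m _.
rewrite -mul_mpolyC -[p@_m in LHS]intz rmorph_int mulrzl rmorphMz; congr (_ *~ _).
rewrite mpolyXE_id rmorph_prod; apply: eq_bigr => i _.
by rewrite rmorphXn.
Qed.

Lemma mpoly_rmorph_ext (f g : {rmorphism {mpoly int[n]} -> A}) :
  (forall i, f 'X_i = g 'X_i) -> f =1 g.
Proof.
move=> e p; rewrite mpoly_rmorphE (mpoly_rmorphE g); congr (zeval_at _ p).
exact/funext.
Qed.

End Zeval.

Section Substitution.
Import mpoly.

(** Algebraic independence of the elementary symmetric functions: the equation in the definition of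
    [Pcomp] has at most one solution. *)
Lemma elem_sym_subst_inj n : injective
  (comp_mpoly [tuple elem_sym id k.+1 | k < n] : {mpoly int[n]} -> {mpoly int[n]}).
Proof. by move=> p q; apply: msym_fundamental_un. Qed.

Definition subst2 n : (n + n).-tuple {mpoly int[n + n]} :=
  [tuple match fintype.split k with
         | inl i => elem_sym (lshift n) i.+1
         | inr j => elem_sym (@rshift n n) j.+1
         end | k < n + n].

(* The substitution is the composite of two substitutions in one set of variables each,
   over Z and over Z[y], once Z[x, y] is identified with Z[y][x]. *)
Lemma elem_sym2_subst_inj n : injective (comp_mpoly (subst2 n)).
Proof.
pose R : comNzRingType := {mpoly int[n]}.
pose S : comNzRingType := {mpoly int[n + n]}.
(* [al] substitutes for the x_i, while [be] acts on the coefficients and substitutes for the y_j.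
   [psi] maps Z[x, y] to Z[y][x] and has the left inverse [the]. *)
pose al : {rmorphism {mpoly R[n]} -> {mpoly R[n]}} :=
  comp_mpoly [tuple mesym n R i.+1 | i < n].
pose be0 : {rmorphism R -> R} := comp_mpoly [tuple mesym n int i.+1 | i < n].
pose be : {rmorphism {mpoly R[n]} -> {mpoly R[n]}} := map_mpoly be0.
pose psi : {rmorphism S -> {mpoly R[n]}} := zeval_at (fun k =>
  match fintype.split k with inl i => 'X_i | inr j => ('X_j : R)%:MP end).
pose the0 : {rmorphism R -> S} := zeval_at (fun j => 'X_(rshift n j)).
pose the : {rmorphism {mpoly R[n]} -> S} := mmap the0 (fun i => 'X_(lshift n i)).
have spl j : fintype.split (lshift n j) = inl j := unsplitK (inl j : 'I_n + 'I_n).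
have spr j : fintype.split (rshift n j) = inr j := unsplitK (inr j : 'I_n + 'I_n).
have psil i : psi 'X_(lshift n i) = 'X_i.
  by rewrite [LHS]zeval_var spl.
have psir j : psi 'X_(rshift n j) = ('X_j : R)%:MP.
  by rewrite [LHS]zeval_var spr.
have psiK : cancel psi the.
  move=> p; pose f : {rmorphism S -> S} := the \o psi.
  apply: (@mpoly_rmorph_ext _ S f (idfun : {rmorphism S -> S})) => k.
  rewrite -[LHS]/(the (psi 'X_k)) -[RHS]/('X_k).
  case: (split_ordP k) => j ->; rewrite ?psil ?psir.
    by rewrite [LHS]mmapX mmap1U.
  by rewrite [LHS]mmapC [LHS]zeval_var.
move=> p q e; suff: psi p = psi q by move/(congr1 the); rewrite !psiK.
have al_inj : injective al by move=> x y; apply: msym_fundamental_un.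
have be_inj : injective be.
  move=> x y exy; apply/mpolyP => m; have := congr1 (mcoeff m) exy.
  rewrite [LHS](mcoeff_map_mpoly be0) [RHS](mcoeff_map_mpoly be0).
  exact: msym_fundamental_un.
apply/be_inj/al_inj.
(* [psi] turns the substitution [subst2] into [be] followed by [al]. Both sides are ring morphisms
   in r, so the variables suffice. *)
suff E r : al (be (psi r)) = psi (r \mPo subst2 n).
  exact: etrans (E p) (etrans (congr1 psi e) (esym (E q))).
pose f : {rmorphism S -> {mpoly R[n]}} := al \o (be \o psi).
pose sb : {rmorphism S -> S} := comp_mpoly (subst2 n).
pose g : {rmorphism S -> {mpoly R[n]}} := psi \o sb.
apply: (@mpoly_rmorph_ext _ _ f g) => k.
rewrite -[LHS]/(al (be (psi 'X_k))) -[RHS]/(psi ('X_k \mPo subst2 n)) comp_mpolyXU.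
rewrite -tnth_nth tnth_mktuple; case: (split_ordP k) => j ->.
  rewrite psil.
  rewrite [be _]map_mpolyX [LHS]comp_mpolyXU -tnth_nth tnth_mktuple.
  rewrite [RHS]rmorph_sum; apply: eq_bigr => h _.
  by rewrite [RHS]rmorph_prod; apply: eq_bigr => i _; rewrite [RHS]psil.
have beC : be ('X_j : R)%:MP = (mesym n int j.+1)%:MP.
  rewrite [LHS]map_mpolyC; congr (_%:MP).
  by rewrite [LHS]comp_mpolyXU -tnth_nth tnth_mktuple.
rewrite psir beC [LHS]comp_mpolyC.
rewrite [LHS](rmorph_sum (mpolyC n (R := R))) [RHS]rmorph_sum.
apply: eq_bigr => h _; rewrite [LHS](rmorph_prod (mpolyC n (R := R))) [RHS]rmorph_prod.
by apply: eq_bigr => i _; rewrite [RHS]psir.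
Qed.

End Substitution.

(** * The polynomials P_n *)

Section Esym.
Variables (I : finType) (A : comPzRingType).

Definition esym_at (x : I -> A) (k : nat) : A :=
  \sum_(h : {set I} | #|h| == k) \prod_(i in h) x i.

Lemma prod_smon (x : I -> A) (h : {set I}) :
  \prod_(i in h) smon 1 (x i) = smon #|h| (\prod_(i in h) x i).
Proof.
rewrite -sum1_card; elim/big_rec3: _ => [|i u k v _ ->]; first by rewrite smon0.
by rewrite smonM.
Qed.

Lemma coefs_prod_linear (x : I -> A) k :
  coefs (\prod_i (1 + smon 1 (x i))) k = esym_at x k.
Proof.
under eq_bigr do rewrite addrC.
rewrite bigA_distr coefs_sum /esym_at [RHS]big_mkcond /=; apply: eq_bigr => h _.
rewrite -big_mkcond /= prod_smon /= eq_sym; by case: eqP.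
Qed.

(** E maps the sum of the [x_i] to the product of the 1 + x_i t, so sums of Teichmueller vectors
    stand for split polynomials. *)
Lemma lser_exp_teich_sum (x : I -> A) k :
  lser (witt_exp (\sum_i teich (x i))) k = esym_at x k.
Proof.
rewrite -coefs_prod_linear -[LHS]/(coefs (lsr _) k) lsr_exp_sum.
by congr coefs; apply: eq_bigr => i _; rewrite lsr_exp_teich.
Qed.

Lemma esym_at_gt (x : I -> A) k : (#|I| < k)%N -> esym_at x k = 0.
Proof.
move=> lt; rewrite /esym_at big_pred0 // => h; apply/negbTE; rewrite neq_ltn.
by rewrite (leq_ltn_trans (max_card _) lt).
Qed.

End Esym.

Section Padding.
Variables (A : Type) (x0 : A) (n : nat).
Definition pad (v : 'I_n -> A) (k : nat) : A := oapp v x0 (insub k).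

Lemma padE (v : 'I_n -> A) k (lt : (k < n)%N) : pad v k = v (Ordinal lt).
Proof. by rewrite /pad insubT. Qed.

End Padding.

Lemma pad_esym (A : comPzRingType) n (x : 'I_n -> A) :
  LambdaSeries (pad 0 (fun i : 'I_n => esym_at x i.+1)) =
  witt_exp (\sum_i teich (x i)).
Proof.
apply: LambdaP => -[|k] //; rewrite lser_exp_teich_sum [LHS]/= /pad.
by case: insubP => [i _ <-|] //=; rewrite -leqNgt => le; rewrite esym_at_gt ?card_ord.
Qed.

Lemma map_pad (A B : comPzRingType) (f : {rmorphism A -> B}) n (v : 'I_n -> A) :
  f \o pad 0 v = pad 0 (f \o v).
Proof. by apply/funext => k; rewrite /pad /=; case: insub => //=; rewrite rmorph0. Qed.

Lemma witt_expE (A : comPzRingType) (a : witt A) : witt_exp_inv (witt_exp a) = a.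
Proof. by apply: witt_exp_inj; rewrite witt_expK. Qed.

Lemma witt_exp_map (A B : comPzRingType) (f : {rmorphism A -> B}) a :
  witt_exp (witt_map f a) = Lambda_map f (witt_exp a).
Proof. by apply: LambdaP => -[|k] //; rewrite lser_exp_map. Qed.

Lemma witt_exp_inv_map (A B : comPzRingType) (f : {rmorphism A -> B}) u :
  witt_map f (witt_exp_inv u) = witt_exp_inv (Lambda_map f u).
Proof. by apply: witt_exp_inj; rewrite witt_exp_map !witt_expK. Qed.

Section ProductCoefficient.

(** The product of W(A) read on power series through E, in degree n; [f 0] is the coefficient of t.
    Being natural in A, it is determined by generic f and g. *)
Definition prod_coef (A : comPzRingType) n (f g : nat -> A) : A :=
  lser (witt_exp (witt_exp_inv (LambdaSeries f) * witt_exp_inv (LambdaSeries g))) n.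

Lemma prod_coef_map (A B : comPzRingType) (h : {rmorphism A -> B}) n f g :
  h (prod_coef n f g) = prod_coef n (h \o f) (h \o g).
Proof. by rewrite /prod_coef -lser_exp_map rmorphM /= !witt_exp_inv_map. Qed.

Lemma eq_ghost (A : comPzRingType) (a b : witt A) n :
  (forall i, (i < n)%N -> wcoef a i = wcoef b i) ->
  forall i, (0 < i <= n)%N -> ghost i a = ghost i b.
Proof.
move=> e i /andP[i0 le]; rewrite /ghost big_seq [RHS]big_seq.
apply: eq_bigr => d; rewrite -dvdn_divisors // => dvd.
have d0 := dvdn_gt0 i0 dvd.
by rewrite /wcomp e // prednK // (leq_trans (dvdn_leq i0 dvd)).
Qed.

(** The first n components of a and b fix w_1, ..., w_n of the product, and these fix the
    coefficient of t^n over a torsion-free ring. Finitely many variables therefore suffice for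
    P_n. *)
Lemma lser_expM_local (A : comPzRingType) (a a' b b' : witt A) n :
  (forall i, (i < n)%N -> wcoef a i = wcoef a' i) ->
  (forall i, (i < n)%N -> wcoef b i = wcoef b' i) ->
  lser (witt_exp (a * b)) n = lser (witt_exp (a' * b')) n.
Proof.
have [F [ev [lift [/wmap_liftK wK tf]]]] := torsion_free_cover A => ea eb.
rewrite -(wK a) -(wK a') -(wK b) -(wK b') -!rmorphM !lser_exp_map; congr (ev _).
apply: (eq_lser_ghost tf) => -[//|i] le.
rewrite rmorphM [RHS]rmorphM /=.
by congr (_ * _); apply: eq_ghost le => j lt; rewrite /= ?ea ?eb.
Qed.

Lemma prod_coef_local (A : comPzRingType) n (f f' g g' : nat -> A) :
  (forall i, (i < n)%N -> f i = f' i) -> (forall i, (i < n)%N -> g i = g' i) ->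
  prod_coef n f g = prod_coef n f' g'.
Proof.
move=> ef eg; apply: lser_expM_local => i lt.
  by apply: (@lser_exp_inj _ _ _ n) lt => -[|k] le //; rewrite !witt_expK; apply: ef.
by apply: (@lser_exp_inj _ _ _ n) lt => -[|k] le //; rewrite !witt_expK; apply: eg.
Qed.

Import mpoly.

Lemma Series_poly_prod (A : comNzRingType) (I : Type) (r : seq I) (F : I -> {poly A}) :
  Series (fun n => (\prod_(i <- r) F i)`_n) = \prod_(i <- r) Series (fun n => (F i)`_n).
Proof.
apply: (big_morph (fun p : {poly A} => Series (fun n => p`_n))) => [p q|].
  by apply: seriesP => n; rewrite /= coefM.
by apply: seriesP => n; rewrite /= coef1.
Qed.

Lemma Series_poly_linear (A : comNzRingType) (c : A) :
  Series (fun n => (1 + c *: 'X : {poly A})`_n) = 1 + smon 1 c.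
Proof.
apply: seriesP => n; rewrite /= coefD coef1 coefZ coefX.
by rewrite mulr_natr.
Qed.

Lemma prod_coef_split (A : comNzRingType) n (x y : 'I_n -> A) :
  prod_coef n (pad 0 (fun i : 'I_n => esym_at x i.+1))
              (pad 0 (fun i : 'I_n => esym_at y i.+1)) =
  (\prod_(i < n) \prod_(j < n) (1 + (x i * y j) *: 'X))`_n.
Proof.
rewrite /prod_coef !pad_esym !witt_expE mulr_suml.
under eq_bigr do rewrite mulr_sumr.
rewrite -[LHS]/(coefs (lsr _) n) lsr_exp_sum.
rewrite -[RHS]/(coefs (Series (fun k => (\prod_(i < n) \prod_(j < n)
  (1 + (x i * y j) *: 'X))`_k)) n) Series_poly_prod.
congr coefs; apply: eq_bigr => i _; rewrite lsr_exp_sum Series_poly_prod.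
by apply: eq_bigr => j _; rewrite Series_poly_linear -teichM lsr_exp_teich.
Qed.

(* The coefficient of t^n in E(E^-1(f) E^-1(g)) for generic f and g satisfies the equation
   that defines P_n, whose solution is unique. *)
Lemma Pprod_prod_coef n :
  Pprod n = prod_coef n (pad 0 (fun i => 'X_(lshift n i))) (pad 0 (fun j => 'X_(rshift n j))).
Proof.
set p := prod_coef _ _ _; pose S : comNzRingType := {mpoly int[n + n]}.
pose sb : {rmorphism S -> S} := comp_mpoly (subst2 n).
have pE : p \mPo subst2 n = (\prod_(i < n) \prod_(j < n)
         (1 + ('X_(lshift n i) * 'X_(rshift n j)) *: 'X))`_n.
  have e1 : sb \o (fun i => 'X_(lshift n i)) =
      fun i : 'I_n => esym_at (fun i => 'X_(lshift n i) : S) i.+1.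
    apply/funext => i; rewrite [LHS]comp_mpolyXU -tnth_nth tnth_mktuple.
    by rewrite (unsplitK (inl i : 'I_n + 'I_n)).
  have e2 : sb \o (fun j => 'X_(rshift n j)) =
      fun j : 'I_n => esym_at (fun j => 'X_(rshift n j) : S) j.+1.
    apply/funext => i; rewrite [LHS]comp_mpolyXU -tnth_nth tnth_mktuple.
    by rewrite (unsplitK (inr i : 'I_n + 'I_n)).
  apply: etrans (prod_coef_map sb _ _ _) _.
  rewrite !(map_pad sb) e1 e2; exact: (@prod_coef_split S).
apply: elem_sym2_subst_inj; apply: etrans _ (esym pE).
exact: (xgetPex _ (ex_intro (fun q : {mpoly int[n + n]} => q \mPo _ = _) p pE)).
Qed.

Lemma Pprod_evalE (A : comPzRingType) n (f g : nat -> A) :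
  Pprod_eval n f g = prod_coef n (f \o succn) (g \o succn).
Proof.
rewrite /Pprod_eval Pprod_prod_coef; set v := (fun k : 'I_(n + n) => _).
rewrite -[LHS]/(zeval_at v _) (prod_coef_map (zeval_at v)) !(map_pad (zeval_at v)).
(* The zeros that [pad] puts at indices from n on do not affect the coefficient of t^n. *)
apply: prod_coef_local => i lt; rewrite padE [LHS]zeval_var /v.
  by rewrite (unsplitK (inl _ : 'I_n + 'I_n)).
by rewrite (unsplitK (inr _ : 'I_n + 'I_n)).
Qed.

Lemma Lambda_mulE (A : comPzRingType) (a b : witt A) :
  Lambda_mul (witt_exp a) (witt_exp b) = witt_exp (a * b).
Proof.
apply: LambdaP => -[|k] //; rewrite [LHS]Pprod_evalE /prod_coef.
have E c : LambdaSeries (lser (witt_exp c) \o succn) = witt_exp c :> Lambda A.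
  by apply: LambdaP => -[|i].
by rewrite !E !witt_expE.
Qed.

End ProductCoefficient.

(** * The polynomials P_(m,n) *)

Section PlethysmCoefficient.

(** The coefficient of t^n in E^2 mu E^-1(1 + f_0 t + ...) is itself a power series, and its
    coefficient of t^m is taken. *)
Definition comp_coef (A : comPzRingType) m n (f : nat -> A) : A :=
  lser (witt_exp (lser (witt_exp (wcomult (witt_exp_inv (LambdaSeries f)))) n)) m.

Lemma comp_coef_map (A B : comPzRingType) (h : {rmorphism A -> B}) m n f :
  h (comp_coef m n f) = comp_coef m n (h \o f).
Proof.
rewrite /comp_coef -lser_exp_map -lser_exp_map wcomult_map witt_exp_inv_map.
by [].
Qed.

(** The coefficient depends only on w_i(w_j(mu a)) = w_(ij)(a) with i <= m and j <= n, and so on the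
    first m n components of a. *)
Lemma lser_comult_local (A : comPzRingType) (a a' : witt A) m n :
  (forall i, (i < m * n)%N -> wcoef a i = wcoef a' i) ->
  lser (witt_exp (lser (witt_exp (wcomult a)) n)) m =
  lser (witt_exp (lser (witt_exp (wcomult a')) n)) m.
Proof.
have [F [ev [lift [/wmap_liftK wK tf]]]] := torsion_free_cover A => e.
rewrite -(wK a) -(wK a') -!wcomult_map !lser_exp_map; congr (ev _).
apply: (eq_lser_ghost tf) => -[//|i] /= im.
rewrite -!(lser_exp_map (@ghost F i.+1)); apply: (eq_lser_ghost tf) => j /andP[j0 jn].
rewrite !ghost_wmap [LHS]ghost_ghost_wcomult // [RHS]ghost_ghost_wcomult //.
apply: (@eq_ghost _ _ _ (m * n)); last by rewrite muln_gt0 j0 leq_mul.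
by move=> k lt; rewrite /= e.
Qed.

Lemma comp_coef_local (A : comPzRingType) m n (f f' : nat -> A) :
  (forall i, (i < m * n)%N -> f i = f' i) -> comp_coef m n f = comp_coef m n f'.
Proof.
move=> ef; apply: lser_comult_local => i lt.
by apply: (@lser_exp_inj _ _ _ (m * n)) lt => -[|k] le //; rewrite !witt_expK; apply: ef.
Qed.

Import mpoly.

Lemma Series_poly_prod_cond (A : comNzRingType) (I : Type) (r : seq I) (P : pred I)
    (F : I -> {poly A}) :
  Series (fun n => (\prod_(i <- r | P i) F i)`_n) =
  \prod_(i <- r | P i) Series (fun n => (F i)`_n).
Proof. by rewrite -big_filter Series_poly_prod big_filter. Qed.

(** Over W(A), the coefficient of t^n in E(sum [[x_i]]) is the n-th elementary symmetric function of
    the [x_i]. By multiplicativity of Teichmueller vectors, it is a sum of Teichmueller vectors of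
    products over n-element sets. *)
Lemma comp_coef_split (A : comNzRingType) m n N (x : 'I_N -> A) :
  comp_coef m n (pad 0 (fun i : 'I_N => esym_at x i.+1)) =
  (\prod_(h : {set 'I_N} | #|h| == n) (1 + (\prod_(i in h) x i) *: 'X))`_m.
Proof.
rewrite /comp_coef pad_esym witt_expE rmorph_sum /=.
under eq_bigr do rewrite wcomult_teich.
rewrite lser_exp_teich_sum /esym_at.
rewrite -[LHS]/(coefs (lsr _) m) lsr_exp_sum.
rewrite -[RHS]/(coefs (Series (fun k => (\prod_(h : {set 'I_N} | #|h| == n)
  (1 + (\prod_(i in h) x i) *: 'X))`_k)) m) Series_poly_prod_cond.
congr coefs; apply: eq_bigr => h _.
by rewrite Series_poly_linear -(big_morph _ (@teichM A) (teich1 A)) lsr_exp_teich.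
Qed.

(** Both sides solve the equation that defines P_(m,n), whose solution is unique. *)
Lemma Pcomp_comp_coef m n :
  Pcomp m n = comp_coef m n (pad 0 (fun i : 'I_(m * n) => 'X_i)).
Proof.
set p := comp_coef _ _ _; pose S : comNzRingType := {mpoly int[m * n]}.
pose s : (m * n).-tuple S := [tuple elem_sym id k.+1 | k < m * n].
pose sb : {rmorphism S -> S} := comp_mpoly s.
have pE : p \mPo s = (\prod_(h : {set 'I_(m * n)} | #|h| == n)
         (1 + (\prod_(i in h) 'X_i) *: 'X))`_m.
  have e : sb \o (fun i => 'X_i) = fun i : 'I_(m * n) => esym_at (fun i => 'X_i : S) i.+1.
    by apply/funext => i; rewrite [LHS]comp_mpolyXU -tnth_nth tnth_mktuple.
  apply: etrans (comp_coef_map sb _ _ _) _.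
  rewrite (map_pad sb) e; exact: (@comp_coef_split S).
apply: elem_sym_subst_inj; apply: etrans _ (esym pE).
exact: (xgetPex _ (ex_intro (fun q : {mpoly int[m * n]} => q \mPo _ = _) p pE)).
Qed.

Lemma Pcomp_evalE (A : comPzRingType) m n (f : nat -> A) :
  Pcomp_eval m n f = comp_coef m n (f \o succn).
Proof.
rewrite /Pcomp_eval Pcomp_comp_coef; pose v (k : 'I_(m * n)) := f k.+1.
rewrite -[LHS]/(zeval_at v _) (comp_coef_map (zeval_at v)) (map_pad (zeval_at v)).
by apply: comp_coef_local => i lt; rewrite padE [LHS]zeval_var.
Qed.

End PlethysmCoefficient.

Lemma LambdaSeries_lser (A : comPzRingType) (f : Lambda A) :
  LambdaSeries (lser f \o succn) = f.
Proof. by apply: LambdaP => -[|i]. Qed.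

Lemma witt_exp1 (A : comPzRingType) : witt_exp (1 : witt A) = Lambda_one A.
Proof.
rewrite -teich1; apply: LambdaP => -[|k] //.
by rewrite -[LHS]/(coefs (lsr _) k.+1) lsr_exp_teich [LHS]add0r.
Qed.

Lemma Lambda_lambdaE (A : comPzRingType) n (a : witt A) :
  Lambda_lambda n (witt_exp a) = witt_exp (lser (witt_exp (wcomult a)) n).
Proof.
rewrite /Lambda_lambda; case: eqP => [->|_]; first by rewrite /= witt_exp1.
apply: LambdaP => -[|k] //.
by rewrite [LHS]Pcomp_evalE /comp_coef LambdaSeries_lser witt_expE.
Qed.

Lemma witt_exp2_inj (A : comPzRingType) : injective (@witt_exp2 A).
Proof.
move=> b c e; apply: witt_exp_inj; apply: LambdaP => -[|k] //.
by apply: witt_exp_inj; have := congr1 (fun f : Lambda (Lambda A) => lambda_coef f k) e.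
Qed.

Lemma witt_exp2_comult (A : comPzRingType) (a : witt A) :
  witt_exp2 (wcomult a) = Lambda_t (witt_exp a).
Proof. by congr LambdaSeries; apply/funext => k; rewrite Lambda_lambdaE. Qed.

(** [witt_comult] chooses a preimage under E^2; [wcomult] provides one, and E^2 is injective. *)
Lemma witt_comultE (A : comPzRingType) : @witt_comult A = @wcomult A.
Proof.
apply/funext => a; apply: witt_exp2_inj; rewrite witt_exp2_comult.
exact: (xgetPex _ (ex_intro (fun b => witt_exp2 b = _) _ (witt_exp2_comult a))).
Qed.

Lemma witt_counitE (A : comPzRingType) (a : witt A) : witt_counit a = wcoef a 0.
Proof.
rewrite -[LHS]/(lser (witt_exp a) 1) lser_exp // /exp_trunc big_geq // coefs1.
by rewrite expr1 mulrN1 opprK add0r.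
Qed.

Lemma witt_lambdaE (A : comPzRingType) n (a : witt A) :
  witt_lambda n a = lser (witt_exp (wcomult a)) n.
Proof. by rewrite /witt_lambda Lambda_lambdaE witt_expE. Qed.

(** * Lambda-rings as coalgebras *)

Lemma Pprod_eval_exp (A : comPzRingType) n (a b : witt A) :
  Pprod_eval n (lser (witt_exp a)) (lser (witt_exp b)) = lser (witt_exp (a * b)) n.
Proof. by rewrite Pprod_evalE /prod_coef !LambdaSeries_lser !witt_expE. Qed.

Lemma Pcomp_eval_exp (A : comPzRingType) m n (a : witt A) :
  Pcomp_eval m n (lser (witt_exp a)) =
  lser (witt_exp (lser (witt_exp (wcomult a)) n)) m.
Proof. by rewrite Pcomp_evalE /comp_coef LambdaSeries_lser witt_expE. Qed.

Section LambdaCoalgebra.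
Variables (A : comPzRingType) (xi : A -> witt A).

Let L n r := lser (witt_exp (xi r)) n.

(** With lambda_t = E xi, the axioms on lambda^1, on 1 and products, on sums and on composites
    correspond to the counit law, multiplicativity, additivity and coassociativity of xi. *)
Lemma coalgebra_lambda_ring :
  zmod_morphism xi -> monoid_morphism xi -> (forall r, wcoef (xi r) 0 = r) ->
  (forall r, witt_map xi (xi r) = wcomult (xi r)) -> is_lambda_ring L.
Proof.
move=> xiB xiM xi0 xiA.
pose iB := GRing.isZmodMorphism.Build A (witt A) xi xiB.
pose iM := GRing.isMonoidMorphism.Build A (witt A) xi xiM.
pose f : {rmorphism A -> witt A} := HB.pack xi iB iM.
have fE r : xi r = f r by [].
split=> // [r|n n1|n r s|n r s|m n r]; rewrite /L.
- rewrite -[RHS]xi0 -[LHS]/(witt_counit (xi r)); exact: witt_counitE.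
- rewrite xiM.1 witt_exp1; by case: n n1 => [|[|n]].
- by rewrite fE rmorphD -[LHS]/(coefs (lsr _) n) lsr_expD coefsM.
- by rewrite xiM.2 -Pprod_eval_exp.
- by rewrite Pcomp_eval_exp -xiA !fE -lser_exp_map.
Qed.

Lemma lambda_ring_coalgebra : is_lambda_ring L ->
  [/\ zmod_morphism xi, monoid_morphism xi, forall r, wcoef (xi r) 0 = r &
      forall r, witt_map xi (xi r) = wcomult (xi r)].
Proof.
case=> _ L1 Lone LD LM LC.
have xiD r s : xi (r + s) = xi r + xi s.
  apply: witt_exp_inj; apply: LambdaP => n.
  by rewrite -[RHS]/(coefs (lsr _) n) lsr_expD coefsM; apply: LD.
have xiB : zmod_morphism xi.
  by move=> r s; apply: (addIr (xi s)); rewrite -xiD !subrK.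
have xi0 r : wcoef (xi r) 0 = r by rewrite -witt_counitE; apply: L1.
have xiM : monoid_morphism xi.
  split=> [|r s]; apply: witt_exp_inj; apply: LambdaP => n.
    rewrite witt_exp1; case: n => [|[|n]] //; first exact: L1.
    exact: (Lone n.+2 isT).
  by rewrite -Pprod_eval_exp; apply: LM.
split=> // r; pose iB := GRing.isZmodMorphism.Build A (witt A) xi xiB.
pose iM := GRing.isMonoidMorphism.Build A (witt A) xi xiM.
pose f : {rmorphism A -> witt A} := HB.pack xi iB iM.
rewrite -[LHS]/(witt_map f (f r)).
(* E is injective over W(A) and over A, which reduces coassociativity to the values L m (L n r). *)
apply: witt_exp_inj; apply: LambdaP => n; apply: witt_exp_inj; apply: LambdaP => m.
rewrite lser_exp_map -Pcomp_eval_exp; exact: LC.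
Qed.

End LambdaCoalgebra.

(** * Congruences modulo an ideal, component by component *)

Section EvalCongruence.
Variables (A : comPzRingType) (J : set A).
Hypothesis idJ : is_ideal J.

Lemma ideal_prod_cong (I : Type) (r : seq I) (P : pred I) (F G : I -> A) :
  (forall i, P i -> J (F i - G i)) ->
  J (\prod_(i <- r | P i) F i - \prod_(i <- r | P i) G i).
Proof.
move=> H; elim/big_ind2: _ => // [|x x' y y' Jx Jy]; first by rewrite subrr; apply: ideal0.
rewrite -(subrKA (x' * y)) -mulrBl -mulrBr.
by apply: (idealD idJ); [|rewrite mulrC]; apply: (idealM idJ).
Qed.

Lemma idealX_cong x y n : J (x - y) -> J (x ^+ n - y ^+ n).
Proof. by move=> Jxy; rewrite subrXX; apply: is_idealMr. Qed.

Lemma idealMz x (c : int) : J x -> J (x *~ c).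
Proof. by move=> Jx; rewrite -mulrzl; apply: idealM. Qed.

Lemma ipoly_eval_cong (I : choiceType) (v w : I -> A) g :
  (forall i, J (v i - w i)) -> J (ipoly_eval v g - ipoly_eval w g).
Proof.
move=> H; rewrite /ipoly_eval -sumrB; apply: is_ideal_sum => // k _.
rewrite -mulrzBl; apply: idealMz; apply: ideal_prod_cong => i _.
exact: idealX_cong.
Qed.

Lemma wadd_cong (a a' b b' : witt A) :
  (forall i, J (wcoef a i - wcoef a' i)) -> (forall i, J (wcoef b i - wcoef b' i)) ->
  forall i, J (wcoef (a + b) i - wcoef (a' + b') i).
Proof.
move=> Ha Hb i; rewrite -[a + b]/(wadd a b) -[a' + b']/(wadd a' b') wadd.unlock.
by apply: ipoly_eval_cong => -[[] j]; [apply: Hb | apply: Ha].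
Qed.

Lemma wmul_cong (a a' b b' : witt A) :
  (forall i, J (wcoef a i - wcoef a' i)) -> (forall i, J (wcoef b i - wcoef b' i)) ->
  forall i, J (wcoef (a * b) i - wcoef (a' * b') i).
Proof.
move=> Ha Hb i; rewrite -[a * b]/(wmul a b) -[a' * b']/(wmul a' b') wmul.unlock.
by apply: ipoly_eval_cong => -[[] j]; [apply: Hb | apply: Ha].
Qed.

Definition witt_ideal : set (witt A) := [set a | forall i, J (wcoef a i)].

Lemma witt_idealP : is_ideal witt_ideal.
Proof.
have subr_wcoef0 (x : witt A) i : wcoef x i - wcoef (0 : witt A) i = wcoef x i.
  by rewrite [wcoef 0 i]/= subr0.
split=> [i|x y Jx Jy i|a x Jx i]; first exact: ideal0.
  have := @wadd_cong x 0 y 0; rewrite addr0 => /(_ _ _ i).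
  by rewrite subr_wcoef0; apply=> j; rewrite subr_wcoef0.
have := @wmul_cong a a x 0; rewrite mulr0 => /(_ _ _ i); rewrite subr_wcoef0.
by apply=> j; rewrite ?subrr ?subr_wcoef0 //; apply: ideal0.
Qed.

(** Subtraction in W(A) is not componentwise. One direction compares b + (a - b) with b + 0, the
    other a - b with b - b. *)
Lemma witt_idealB (a b : witt A) :
  witt_ideal (a - b) <-> forall i, J (wcoef a i - wcoef b i).
Proof.
split=> [Jab i|Jab].
  have := @wadd_cong b b (a - b) 0; rewrite addr0 subrKC => /(_ _ _ i).
  by apply=> j; rewrite ?subrr ?[wcoef 0 j]/= ?subr0 //; apply: ideal0.
have := @wadd_cong a b (- b) (- b); rewrite subrr => /(_ _ _ _).
move=> H i; have := H Jab _ i; rewrite [wcoef 0 i]/= subr0; apply=> j.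
by rewrite subrr; apply: ideal0.
Qed.

End EvalCongruence.

(** * Filtrations *)

Section EvalProduct.
Variables (A : comPzRingType) (J1 J2 K : set A).
Hypotheses (id1 : is_ideal J1) (id2 : is_ideal J2) (idK : is_ideal K).
Hypothesis JK : forall x y, J1 x -> J2 y -> K (x * y).

(** Setting one family of variables to 1 isolates the part of a monomial in the other family. *)
Lemma mon_eval_pair (a b : witt A) k : mon_eval (pair_val a b) k =
  mon_eval (pair_val a (Witt (fun=> 1))) k * mon_eval (pair_val (Witt (fun=> 1)) b) k.
Proof.
rewrite /mon_eval -big_split; apply: eq_bigr => -[[] i] _ /=;
  by rewrite /pair_val /= expr1n ?mulr1 ?mul1r.
Qed.

(* The terms f(a, b) - f(a, 0) - f(0, b) + f(0, 0) keep only the monomials of f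
   in which variables of both kinds occur. *)
Lemma ipoly_eval_pair_mixed (a b : witt A) g :
  (forall i, J1 (wcoef a i)) -> (forall i, J2 (wcoef b i)) ->
  K (ipoly_eval (pair_val a b) g - ipoly_eval (pair_val a 0) g
     - (ipoly_eval (pair_val 0 b) g - ipoly_eval (pair_val 0 0) g)).
Proof.
move=> Ja Jb; rewrite /ipoly_eval -!sumrB; apply: is_ideal_sum => // k _.
rewrite -!mulrzBl; apply: idealMz => //.
rewrite (mon_eval_pair a b) (mon_eval_pair a 0) (mon_eval_pair 0 b) (mon_eval_pair 0 0).
(* For a monomial p(x) q(y) the mixed difference is (p(a) - p(0)) (q(b) - q(0)). *)
rewrite -!mulrBr -mulrBl; apply: JK.
  apply: ideal_prod_cong => // -[[] i] _; apply: idealX_cong => //; rewrite /pair_val /=.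
    by rewrite subrr; apply: ideal0.
  by rewrite subr0.
apply: ideal_prod_cong => // -[[] i] _; apply: idealX_cong => //; rewrite /pair_val /=.
  by rewrite subr0.
by rewrite subrr; apply: ideal0.
Qed.

(** Products with the zero vector vanish, so the mixed difference of a multiplication polynomial is
    its value at (a, b). *)
Lemma witt_idealM (a b : witt A) :
  witt_ideal J1 a -> witt_ideal J2 b -> witt_ideal K (a * b).
Proof.
move=> Ja Jb i; have mulE (x y : witt A) :
    wcoef (x * y) i = ipoly_eval (pair_val x y) (wcoef wmul_poly i).
  by rewrite -[x * y]/(wmul x y) wmul.unlock.
have := ipoly_eval_pair_mixed (wcoef wmul_poly i) Ja Jb.
by rewrite -!mulE !mul0r mulr0 !subr0.
Qed.

End EvalProduct.

Lemma witt_fil_filtration (X : filtRing) : is_filtration (@witt_fil X).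
Proof.
have F := filP X; split=> [n||n a|n m a b].
- exact/witt_idealP/(fil_ideal F).
- by rewrite predeqE => a; split=> // _ i; rewrite (fil0 F).
- by move=> Ja i; apply: (fil_dec F).
apply: witt_idealM; try exact: (fil_ideal F).
by move=> x y; apply: (filM F).
Qed.

Section FiltHomMorphism.
Variables (X Y : filtRing) (f : filtHom X Y).

Definition filt_rmorph : {rmorphism X -> Y} :=
  let: And3 fB fM _ := fhomP f in
  HB.pack (f : X -> Y) (GRing.isZmodMorphism.Build X Y f fB)
    (GRing.isMonoidMorphism.Build X Y f fM).

Lemma filt_rmorphE : filt_rmorph =1 f.
Proof. by rewrite /filt_rmorph; case: fhomP. Qed.

End FiltHomMorphism.

(** * Completeness and the Hausdorff property *)

Section Completeness.
Variable X : filtRing.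

Lemma fil_cosetP n (x y : X) : fil_coset n x = fil_coset n y <-> fil X n (y - x).
Proof.
have idn := fil_ideal (filP X) n; rewrite /fil_coset; split=> [e|xy].
  have : [set z | fil X n (z - y)] y by rewrite /= subrr; apply: ideal0.
  by rewrite -e.
rewrite predeqE => z /=; split=> H.
  by rewrite -(subrKA x) -[x - y]opprB; apply: is_idealB.
by rewrite -(subrKA y); apply: idealD.
Qed.

Lemma fil_hausdorffP :
  fil_hausdorff X <-> forall x y : X, (forall n, fil X n (y - x)) -> x = y.
Proof.
split=> [H x y xy|H x y e].
  apply: H; apply: eq_exist => /=; apply/funext => n; exact/fil_cosetP.
apply: H => n; apply/fil_cosetP; exact: (congr1 (fun s : fil_limit X => sval s n) e).
Qed.

(** Choosing representatives turns a point of the inverse limit into a sequence with s_(n+1) = s_n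
    modulo I^n, and conversely. *)
Lemma fil_completeP :
  fil_complete X <-> forall s : nat -> X, (forall n, fil X n (s n.+1 - s n)) ->
    exists x, forall n, fil X n (x - s n).
Proof.
have F := filP X; split=> [C s sC|C [s sP]].
  have sP n : exists x, fil_coset n.+1 (s n.+1) = fil_coset n.+1 x /\
      fil_coset n (s n) = fil_coset n x.
    by exists (s n.+1); split=> //; apply/fil_cosetP.
  have [x xE] := C (exist _ (fun n => fil_coset n (s n)) sP).
  exists x => n; apply/fil_cosetP; exact/esym/(congr1 (fun s : fil_limit X => sval s n) xE).
(* Both [t n] and [t n.+1] represent the coset [s n.+1], so they agree even modulo I^(n+1). *)
have /choice[t tE] := sP; have [n|x xE] := C t.
  apply: (fil_dec F); apply/fil_cosetP.
  by have [<- _] := tE n; have [_ <-] := tE n.+1.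
exists x; apply: eq_exist => /=; apply/funext => n; have [_ ->] := tE n.
by apply/esym/fil_cosetP.
Qed.

End Completeness.

Section WittCompleteness.
Variable X : filtRing.
Let WX := FiltRing (witt_fil_filtration X).

Lemma witt_filB n (a b : WX) :
  fil WX n (a - b) <-> forall i, fil X n (wcoef a i - wcoef b i).
Proof. exact/witt_idealB/(fil_ideal (filP X)). Qed.

Lemma witt_hausdorff : fil_hausdorff X <-> fil_hausdorff WX.
Proof.
rewrite !fil_hausdorffP; split=> [H a b ab|H x y xy].
  by apply: wittP => i; apply: H => n; move: i; apply/witt_filB.
(* Vectors with all components equal inherit the congruences of X by [witt_filB]. *)
suff /(congr1 (fun a => wcoef a 0%N)) : Witt (fun=> x) = Witt (fun=> y) by [].
by apply: H => n; apply/witt_filB.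
Qed.

Lemma witt_complete : fil_complete X <-> fil_complete WX.
Proof.
rewrite !fil_completeP; split=> [C s sC|C s sC].
  have /choice[x xP] : forall i, exists x, forall n, fil X n (x - wcoef (s n) i).
    move=> i; apply: C => n; move: i; apply/witt_filB; exact: sC.
  by exists (Witt x) => n; apply/witt_filB => i; apply: xP.
have [n|a aP] := C (fun n => Witt (fun=> s n)).
  by apply/witt_filB => i; apply: sC.
by exists (wcoef a 0%N) => n; have /witt_filB/(_ 0%N) := aP n.
Qed.

End WittCompleteness.

(** * The comonad on filtered rings *)

Local Notation WF := (witt_filt witt_fil_filtration).

Lemma filt_rmorphK (X Y : filtRing) (f : filtHom X Y) : (filt_rmorph f : X -> Y) = f.
Proof. exact/funext/filt_rmorphE. Qed.

Lemma witt_map_filt_hom (X Y : filtRing) (f : filtHom X Y) :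
  @is_filt_hom (WF X) (WF Y) (witt_map f).
Proof.
rewrite -filt_rmorphK; have [fB fM] := witt_map_rmorph (filt_rmorph f).
split=> // n a Ja i; rewrite /= filt_rmorphE.
by have [_ _ fF] := fhomP f; apply/fF/Ja.
Qed.

Lemma witt_counit_ghost (A : comPzRingType) : @witt_counit A = @ghost A 1.
Proof. by apply/funext => a; rewrite witt_counitE ghost1. Qed.

Lemma witt_counit_filt_hom (X : filtRing) : @is_filt_hom (WF X) X (@witt_counit X).
Proof.
rewrite witt_counit_ghost; have [gB gM] := @ghost_rmorph X 1 isT.
by split=> // n a Ja; rewrite ghost1; apply: Ja.
Qed.

(** The components of mu(a) are integer polynomials in those of a, and they vanish at a = 0. *)
Lemma wcomult_ideal (A : comPzRingType) (J : set A) (a : witt A) : is_ideal J ->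
  witt_ideal J a -> forall i, witt_ideal J (wcoef (wcomult a) i).
Proof.
move=> idJ Ja i j.
have E (b : witt A) : wcoef (wcoef (wcomult b) i) j =
    ipoly_eval (wcoef b) (wcoef (wcoef comult_poly i) j).
  by rewrite wcomult.unlock.
have a0 k : J (wcoef a k - wcoef (0 : witt A) k) by rewrite subr0; apply: Ja.
have := ipoly_eval_cong idJ (wcoef (wcoef comult_poly i) j) a0.
by rewrite -!E raddf0 subr0.
Qed.

Lemma witt_comult_filt_hom (X : filtRing) :
  @is_filt_hom (WF X) (WF (WF X)) (@witt_comult X).
Proof.
rewrite witt_comultE; split; [exact: wcomult_zmod | exact: wcomult_monoid |].
by move=> n a Ja i; apply: wcomult_ideal => //; apply: (fil_ideal (filP X)).
Qed.

Definition Wfun : functor_data filtRingCat := witt_functor witt_map_filt_hom.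
Definition Weta (X : filtRingCat) : arrow (Wfun X) X := FiltHom (witt_counit_filt_hom X).
Definition Wmu (X : filtRingCat) : arrow (Wfun X) (Wfun (Wfun X)) :=
  FiltHom (witt_comult_filt_hom X).

Lemma Wfun_functor : is_functor Wfun.
Proof. by split=> *; apply: filtHom_ext => a; apply: wittP. Qed.

Lemma Wfun_comonad : is_comonad Weta Wmu.
Proof.
split; first exact: Wfun_functor.
- by move=> X Y f; apply: filtHom_ext => a; rewrite /= !witt_counitE.
- move=> X Y f; apply: filtHom_ext => a.
  by rewrite /= !witt_comultE -filt_rmorphK wcomult_map.
- move=> X; apply: filtHom_ext => a.
  by rewrite /= witt_comultE witt_counit_ghost wcomult_counitl.
- move=> X; apply: filtHom_ext => a.
  by rewrite /= witt_comultE witt_counit_ghost wcomult_counitr.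
- by move=> X; apply: filtHom_ext => a; rewrite /= !witt_comultE wcomultA.
Qed.

Lemma witt_expD (A : comPzRingType) :
  {morph @witt_exp A : a b / a + b >-> Lambda_add a b}.
Proof.
move=> a b; apply: LambdaP => -[|k] //.
by rewrite -[LHS]/(coefs (lsr _) k.+1) lsr_expD.
Qed.

(** W(A) is a coalgebra with mu as its coaction: the laws are a counit law and coassociativity. *)
Lemma witt_lambda_ring (A : comPzRingType) : is_lambda_ring (@witt_lambda A).
Proof.
have -> : @witt_lambda A = fun n a => lser (witt_exp (wcomult a)) n.
  by apply/funext => n; apply/funext => a; apply: witt_lambdaE.
apply: coalgebra_lambda_ring; [exact: wcomult_zmod | exact: wcomult_monoid | |].
  by move=> a; rewrite -ghost1 wcomult_counitr.
exact: wcomultA.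
Qed.

Lemma witt_filt_lambda (X : filtRing) : is_filt_lambda (X := WF X) (@witt_lambda X).
Proof.
split; first exact: witt_lambda_ring.
move=> n [//|i] a _ Ja; rewrite witt_lambdaE.
have idn := fil_ideal (filP X) n.
(* [witt_exp_ideal] is applied over the ring W(X), to the ideal W(I^n). *)
by apply: (iffLR (witt_exp_ideal (witt_idealP idn) _)); apply: wcomult_ideal.
Qed.

(** * Filtered lambda-ring structures as coalgebras *)

Section Coalgebras.
Variable X : filtRing.

Definition coaction (L : filt_lambda X) (x : X) : witt X :=
  witt_exp_inv (lambda_t (sval L) x).

Lemma lser_coaction L n x : lser (witt_exp (coaction L x)) n = sval L n x.
Proof.
rewrite /coaction witt_expK; case: n => //=.
by case: (svalP L) => LR _; rewrite (lambda0 LR).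
Qed.

Lemma coaction_coalgebra_laws L :
  [/\ zmod_morphism (coaction L), monoid_morphism (coaction L),
      forall r, wcoef (coaction L r) 0 = r &
      forall r, witt_map (coaction L) (coaction L r) = wcomult (coaction L r)].
Proof.
apply: lambda_ring_coalgebra; have [LR _] := svalP L.
have <- // : sval L = fun n r => lser (witt_exp (coaction L r)) n.
by apply/funext => n; apply/funext => r; rewrite lser_coaction.
Qed.

Lemma coaction_filt_hom L : @is_filt_hom X (WF X) (coaction L).
Proof.
have [xB xM _ _] := coaction_coalgebra_laws L; split=> // n x Jx.
apply: (iffRL (witt_exp_ideal (fil_ideal (filP X) n) _)) => k.
rewrite -[lambda_coef _ k]/(lser _ k.+1) lser_coaction.
by have [_ LF] := svalP L; apply: LF.
Qed.

Definition coaction_hom L : arrow (X : filtRingCat) (Wfun X) :=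
  FiltHom (coaction_filt_hom L).

Lemma coaction_coalgebra L : is_coalgebra Weta Wmu (coaction_hom L).
Proof.
have [_ _ x0 xA] := coaction_coalgebra_laws L.
split; apply: filtHom_ext => r /=; first by rewrite witt_comultE xA.
by rewrite witt_counitE x0.
Qed.

Definition coalgebra_lambda (xi : X -> witt X) (n : nat) (r : X) : X :=
  lser (witt_exp (xi r)) n.

Lemma coalgebra_filt_lambda (xi : filtHom X (WF X)) :
  is_coalgebra (X := X) Weta Wmu xi -> is_filt_lambda (coalgebra_lambda xi).
Proof.
have [xB xM xF] := fhomP xi.
case=> /(congr1 (@fhom _ _)) xA /(congr1 (@fhom _ _)) x0; split.
  apply: coalgebra_lambda_ring => // r.
    by rewrite -witt_counitE; apply: (congr1 (fun f => f r) x0).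
  by rewrite -witt_comultE; apply: (congr1 (fun f => f r) xA).
move=> n [//|i] r _ Jr; have Jxi := xF n r Jr.
exact: (iffLR (witt_exp_ideal (fil_ideal (filP X) n) _) Jxi).
Qed.

Lemma coaction_lambda (L : filt_lambda X) (xi : X -> witt X) :
  sval L = coalgebra_lambda xi -> coaction L = xi.
Proof.
move=> e; apply/funext => x; apply: witt_exp_inj; apply: LambdaP => n.
by rewrite lser_coaction e.
Qed.

Lemma coaction_inj : injective coaction.
Proof.
move=> L L' e; have : sval L = sval L'.
  by apply/funext => n; apply/funext => x; rewrite -!lser_coaction e.
by case: L L' {e} => [L LP] [L' LP'] /= e; apply: eq_exist.
Qed.

End Coalgebras.

(** * The topology on the set of lambda-ring structures *)

Lemma filtHom_continuous (X Y : filtRing) (f : filtHom X Y) :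
  continuous (f : filt_space X -> filt_space Y).
Proof.
have [fB _ fF] := fhomP f.
apply/continuousP => U oU; suff: @filt_open X (f @^-1` U) by [].
move: oU; rewrite -[open U]/(@filt_open Y U) => oU x Ux.
have [n nU] := oU _ Ux; exists n => y xy.
by apply: nU; rewrite /fil_coset /= -fB; apply: fF.
Qed.

(** The source has the initial topology along j and the target the one along the inclusion, so
    continuity in either direction is that of the composite with [j] or [set_val]. *)
Lemma homeomorphism_onto (S : choiceType) (C : topologicalType) (A : set C) (j : S -> C)
    (h : initial_topology j -> A) :
  (forall L, set_val (h L) = j L) -> injective j ->
  (forall c, A c -> exists L, j L = c) -> homeomorphism h.
Proof.
move=> hE j_inj j_surj; split.
  apply: continuous_comp_initial.
  by have -> : set_val \o h = j by [apply/funext => L; apply: hE]; apply: initial_continuous.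
have /choice[g gE] (c : A) : exists L, j L = set_val c by apply/j_surj/set_mem/(valP c).
exists g; split=> [L|c|].
- by apply: j_inj; rewrite gE hE.
- by apply: val_inj; rewrite -[LHS]/(set_val (h (g c))) hE gE.
apply: continuous_comp_initial.
by have -> : j \o g = set_val by [apply/funext => c; apply: gE]; apply: initial_continuous.
Qed.

Theorem theorem1 :
  (* (1) *)
  exists (obP : forall X : filtRing, is_filtration (@witt_fil X))
         (morP : forall (X Y : filtRing) (f : filtHom X Y),
            @is_filt_hom (witt_filt obP X) (witt_filt obP Y) (witt_map f)),
  let W : functor_data filtRingCat := witt_functor morP in
  is_functor W /\
  (* (2) *)
  exists (etaP : forall X : filtRing,
            @is_filt_hom (witt_filt obP X) X (@witt_counit X))
         (muP : forall X : filtRing,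
            @is_filt_hom (witt_filt obP X) (witt_filt obP (witt_filt obP X))
              (@witt_comult X)),
  let eta (X : filtRingCat) : arrow (W X) X := FiltHom (etaP X) in
  let mu (X : filtRingCat) : arrow (W X) (W (W X)) := FiltHom (muP X) in
  is_comonad eta mu /\
  forall X : filtRing,
  let WX : filtRing := witt_filt obP X in
  let lambda_coaction (L : filt_lambda X) (x : X) : witt X :=
    witt_exp_inv (lambda_t (sval L) x) in
  [/\ (* (3) *)
      [/\ bijective (@witt_exp X),
          {morph @witt_exp X : a b / a + b >-> Lambda_add a b},
          {morph @witt_exp X : a b / a * b >-> Lambda_mul a b},
          witt_exp (1 : witt X) = Lambda_one X
        & @is_filt_lambda WX (@witt_lambda X)],
      (* (4) *)
      (fil_complete X <-> fil_complete WX) /\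
      (fil_hausdorff X <-> fil_hausdorff WX),
      (* (5) *)
      exists Phi : filt_lambda X ->
                   {xi : arrow (X : filtRingCat) (W X) | is_coalgebra eta mu xi},
        (forall L x, (sval (Phi L) : filtHom X WX) x = lambda_coaction L x) /\
        bijective Phi
    & let C := cts_space (filt_space X) (filt_space WX) in
      let coalgebras : set C :=
        [set f : C | exists2 xi : arrow (X : filtRingCat) (W X),
           is_coalgebra eta mu xi &
           forall x, (f : continuousType (filt_space X) (filt_space WX)) x
                     = (xi : filtHom X WX) x] in
      exists j : filt_lambda X -> C,
        (forall L x,
           (j L : continuousType (filt_space X) (filt_space WX)) x
           = lambda_coaction L x) /\
        exists h : initial_topology j -> coalgebras,
          (forall L, set_val (h L) = j L) /\ homeomorphism h].
Proof.
exists witt_fil_filtration, witt_map_filt_hom; split; first exact: Wfun_functor.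
exists witt_counit_filt_hom, witt_comult_filt_hom; split; first exact: Wfun_comonad.
move=> X WX lambda_coaction; split.
- split; [exact: witt_exp_bij | exact: witt_expD | | exact: witt_exp1 |].
    by move=> a b; rewrite Lambda_mulE.
  exact: witt_filt_lambda.
- by split; [exact: witt_complete | exact: witt_hausdorff].
- exists (fun L => exist _ (coaction_hom L) (coaction_coalgebra L)); split=> //.
  (* The inverse reads the operations off the coefficients of E xi. *)
  exists (fun xi => exist _ _ (coalgebra_filt_lambda (svalP xi))) => [L|[xi xiP]].
    by apply: coaction_inj; apply: coaction_lambda.
  by apply: eq_exist; apply: filtHom_ext => x /=; rewrite (@coaction_lambda _ _ xi).
move=> C coalgebras.
pose j (L : filt_lambda X) : C := mkcts (@filtHom_continuous X WX (coaction_hom L)).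
exists j; split=> //.
have jP L : coalgebras (j L).
  suff : exists2 xi : arrow (X : filtRingCat) (Wfun X), is_coalgebra Weta Wmu xi &
    forall x, coaction_hom L x = (xi : filtHom X WX) x by [].
  by exists (coaction_hom L) => //; apply: coaction_coalgebra.
pose h (L : initial_topology j) : coalgebras := exist _ (j L) (mem_set (jP L)).
exists h; split=> //; apply: homeomorphism_onto => // [L L' e|c [xi xiP cE]].
  apply: coaction_inj.
  exact: (congr1 (fun f : continuousType (filt_space X) (filt_space WX) => f : X -> WX) e).
exists (exist _ _ (coalgebra_filt_lambda xiP)); apply/continuousEP => x.
rewrite cE; exact: (congr1 (fun f => f x) (@coaction_lambda _ (exist _ _ _) xi _)).
Qed.
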